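(* For every $\varepsilon>0$, $Th(\mathcal{B})\notin DTIME\bigl(\exp(D^{-\rho}\cdot n^{\rho})\bigr)$, where $\rho=(2+\varepsilon)^{-1}$ and $D=D(\varepsilon)>0$ is a constant such that to every deterministic Turing machine $P$ and every input string $X$ there is assigned a sentence $\Omega(X,P)$ of the signature of $\mathcal{B}$ with: (i) for some polynomial $g$, the code $c_O\,\Omega(X,P)$ is written within time $g(|X|,|c_OP|)$ for all $X,P$; (ii) $Th(\mathcal{B})\vdash\Omega(X,P)$ if and only if $P$ accepts $X$ within time $\exp(|X|)$; (iii) for every $P$, $|X|<|c_O\,\Omega(X,P)|\leqslant D\cdot|c_OP|\cdot|X|^{2+\varepsilon}$ for all sufficiently long $X$.
   Context: $|Y|$ is the number of symbols of a word $Y$; $\exp(n)=2^{n}$; $n$ is the length of the input string. $\mathcal{B}$ is the Boolean algebra with exactly two elements, in the signature $\langle\cap,\cup,C,0,1\rangle$ with equality; $Th(\mathcal{B})$ is its first-order theory. (The existence of such a constant $D$ and such sentences $\Omega(X,P)$ for every $\varepsilon>0$ is the main theorem of the paper.) Turing machines are deterministic, with a fixed finite tape alphabet $A$ containing at least a blank symbol $\Lambda$, a start symbol $\rhd$ (never written or erased), and $0,1$; the simulated machines have one tape, infinite to the right only, containing initially $\rhd$, then the input, then blanks; the head starts at the left end in state $q_0$; the accepting state is $q_1$, the rejecting one $q_2$; instructions have the form $q_i\alpha\to q_j\beta$ with $\alpha\in A$, $\beta\in A\cup\{R,L\}$. $c_O$ is a fixed polynomial encoding (encoding and unique decoding in polynomial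 time) of formulae and programs $M$, written as finite words with indices in decimal notation, by strings $c_OM\in A^{*}$, such that $|M|\leqslant|c_OM|\leqslant l(|M|)$ for a fixed linear function $l$, and the code of each instruction of a program is a constituent of the code of the program. *)

(* Defs.v *)
From HB Require Import structures.
From mathcomp Require Import all_boot all_order all_algebra.
From mathcomp Require Import reals exp.

Set Implicit Arguments.
Unset Strict Implicit.
Unset Printing Implicit Defensive.

Import Order.TTheory GRing.Theory Num.Theory.

Inductive term : Type :=
| Var of nat
| Zero
| One
| Compl of term
| Cap of term & term
| Cup of term & term.

Inductive formula : Type :=
| Eq of term & term
| Not of formula
| And of formula & formula
| Or of formula & formula
| Imp of formula & formula
| All of nat & formula
| Ex of nat & formula.

Fixpoint term_vars (t : term) : seq nat :=
  match t with
  | Var n => [:: n]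
  | Zero | One => [::]
  | Compl t1 => term_vars t1
  | Cap t1 t2 | Cup t1 t2 => term_vars t1 ++ term_vars t2
  end.

Fixpoint free_vars (f : formula) : seq nat :=
  match f with
  | Eq t1 t2 => term_vars t1 ++ term_vars t2
  | Not f1 => free_vars f1
  | And f1 f2 | Or f1 f2 | Imp f1 f2 => free_vars f1 ++ free_vars f2
  | All n f1 | Ex n f1 => filter (predC1 n) (free_vars f1)
  end.

Record sentence := Sentence {
  sentence_formula :> formula;
  _ : free_vars sentence_formula == [::] }.

Record structure := Structure {
  carrier :> Type;
  s_zero : carrier;
  s_one : carrier;
  s_compl : carrier -> carrier;
  s_cap : carrier -> carrier -> carrier;
  s_cup : carrier -> carrier -> carrier }.

Fixpoint eval (S : structure) (v : nat -> S) (t : term) : S :=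
  match t with
  | Var n => v n
  | Zero => s_zero S
  | One => s_one S
  | Compl t1 => s_compl (eval v t1)
  | Cap t1 t2 => s_cap (eval v t1) (eval v t2)
  | Cup t1 t2 => s_cup (eval v t1) (eval v t2)
  end.

Definition update (T : Type) (v : nat -> T) (n : nat) (a : T) : nat -> T :=
  fun m => if m == n then a else v m.

Fixpoint sat (S : structure) (v : nat -> S) (f : formula) : Prop :=
  match f with
  | Eq t1 t2 => eval v t1 = eval v t2
  | Not f1 => ~ sat v f1
  | And f1 f2 => sat v f1 /\ sat v f2
  | Or f1 f2 => sat v f1 \/ sat v f2
  | Imp f1 f2 => sat v f1 -> sat v f2
  | All n f1 => forall a : S, sat (update v n a) f1
  | Ex n f1 => exists a : S, sat (update v n a) f1
  end.

Definition models (S : structure) (f : sentence) : Prop :=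
  forall v : nat -> S, sat v f.

Definition Th (S : structure) : sentence -> Prop := models S.

(* T |- f is rendered by consequence over all structures of the signature,
   which is derivability by Goedel's completeness theorem. *)
Definition entails (T : sentence -> Prop) (f : sentence) : Prop :=
  forall S : structure, (forall g, T g -> models S g) -> models S f.

Definition two_BA : structure := Structure false true negb andb orb.

Record alphabet := Alphabet {
  letter :> finType;
  blank : letter;
  start : letter;
  bit0 : letter;
  bit1 : letter;
  alphabet_uniq : uniq [:: blank; start; bit0; bit1] }.

Section Machines.

Variables (A : alphabet) (k : nat).

(* [inl b] writes b, [inr true] is R and [inr false] is L. *)
Definition action : Type := (A + bool)%type.

(* ((i, a), (j, b)) is the instruction  q_i a -> q_j b ; on k tapes, a and b
   are k-tuples. *)
Definition instruction : Type :=
  ((nat * k.-tuple A) * (nat * k.-tuple action))%type.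

Definition preserves_start (I : instruction) : bool :=
  [forall i : 'I_k,
    if tnth I.2.2 i is inl b
    then (tnth I.1.2 i != start A) && (b != start A) else true].

Record machine := Machine {
  program :> seq instruction;
  _ : uniq [seq r.1 | r <- program];
  _ : all preserves_start program }.

Record config := Config {
  state : nat;
  pos : 'I_k -> nat;
  cell : 'I_k -> nat -> A }.

Definition scanned (c : config) : k.-tuple A :=
  [tuple cell c i (pos c i) | i < k].

(* L at the left end of a tape leaves the head where it is. *)
Definition apply_actions (c : config) (q : nat) (b : k.-tuple action) : config :=
  Config q
    (fun i => match tnth b i with
              | inl _ => pos c i
              | inr true => (pos c i).+1
              | inr false => (pos c i).-1
              end)
    (fun i n => if tnth b i is inl x
                then if n == pos c i then x else cell c i n
                else cell c i n).

Definition accepting (c : config) : bool := state c == 1.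
Definition rejecting (c : config) : bool := state c == 2.

(* q_1 and q_2 are halting; a configuration to which no instruction applies
   is repeated forever, without acceptance or rejection. *)
Definition step (M : machine) (c : config) : config :=
  if accepting c || rejecting c then c
  else if [seq r.2 | r <- program M & r.1 == (state c, scanned c)] is r :: _
       then apply_actions c r.1 r.2 else c.

Definition run (M : machine) (t : nat) (c : config) : config :=
  iter t (step M) c.

Definition tape_of (w : seq A) : nat -> A := nth (blank A) (start A :: w).

(* The i-th tape initially holds the i-th word of ws, the tapes beyond
   [size ws] hold the empty word. *)
Definition initial (ws : seq (seq A)) : config :=
  Config 0 (fun=> 0) (fun i => tape_of (nth [::] ws i)).

End Machines.

(* Inputs avoid the blank, so that the end of the input is visible on the
   tape, and the start symbol, which marks the left end only. *)
Definition is_word (A : alphabet) (w : seq A) : bool :=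
  all (fun a => (a != blank A) && (a != start A)) w.

Definition accepts_within (A : alphabet) (P : machine A 1) (X : seq A)
    (T : nat) : Prop :=
  exists2 t, t <= T & accepting (run P t (initial 1 [:: X])).

(* The output is left on the first tape. *)
Definition outputs_within (A : alphabet) (k : nat) (M : machine A k.+1)
    (ws : seq (seq A)) (out : seq A) (T : nat) : Prop :=
  exists2 t, t <= T &
    accepting (run M t (initial k.+1 ws)) /\
    cell (run M t (initial k.+1 ws)) ord0 =1 tape_of out.

(* Time O(f) on a deterministic machine with any number of tapes. *)
Definition DTIME (R : realType) (A : alphabet) (f : nat -> R)
    (L : seq A -> Prop) : Prop :=
  exists (k : nat) (M : machine A k.+1) (c : R),
    forall x : seq A, is_word x ->
      exists2 t : nat, (t%:R <= c * f (size x))%R &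
        let final := run M t (initial k.+1 [:: x]) in
        (accepting final /\ L x) \/ (rejecting final /\ ~ L x).

Inductive keyword : Set :=
| KLpar | KRpar | KEq | KNot | KAnd | KOr | KImp | KAll | KEx
| KVar | KZero | KOne | KCompl | KCap | KCup
| KState | KArrow | KRight | KLeft | KSemi.

Definition keywords : seq keyword :=
  [:: KLpar; KRpar; KEq; KNot; KAnd; KOr; KImp; KAll; KEx;
      KVar; KZero; KOne; KCompl; KCap; KCup;
      KState; KArrow; KRight; KLeft; KSemi].

Definition keyword_index (s : keyword) : 'I_20 :=
  match s with
  | KLpar => @Ordinal 20 0 isT | KRpar => @Ordinal 20 1 isT
  | KEq => @Ordinal 20 2 isT | KNot => @Ordinal 20 3 isT
  | KAnd => @Ordinal 20 4 isT | KOr => @Ordinal 20 5 isT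
  | KImp => @Ordinal 20 6 isT | KAll => @Ordinal 20 7 isT
  | KEx => @Ordinal 20 8 isT | KVar => @Ordinal 20 9 isT
  | KZero => @Ordinal 20 10 isT | KOne => @Ordinal 20 11 isT
  | KCompl => @Ordinal 20 12 isT | KCap => @Ordinal 20 13 isT
  | KCup => @Ordinal 20 14 isT | KState => @Ordinal 20 15 isT
  | KArrow => @Ordinal 20 16 isT | KRight => @Ordinal 20 17 isT
  | KLeft => @Ordinal 20 18 isT | KSemi => @Ordinal 20 19 isT
  end.

Lemma keyword_indexK :
  cancel keyword_index (fun i : 'I_20 => nth KLpar keywords i).
Proof. by case. Qed.

HB.instance Definition _ := Finite.copy keyword (can_type keyword_indexK).

Section Writing.

Variable A : alphabet.

Definition symbol : Type := (A + ('I_10 + keyword))%type.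

Definition kw (s : keyword) : symbol := inr (inr s).
Definition digit (d : 'I_10) : symbol := inr (inl d).

Fixpoint write_uint (u : Decimal.uint) : seq symbol :=
  match u with
  | Decimal.Nil => [::]
  | Decimal.D0 v => digit (@Ordinal 10 0 isT) :: write_uint v
  | Decimal.D1 v => digit (@Ordinal 10 1 isT) :: write_uint v
  | Decimal.D2 v => digit (@Ordinal 10 2 isT) :: write_uint v
  | Decimal.D3 v => digit (@Ordinal 10 3 isT) :: write_uint v
  | Decimal.D4 v => digit (@Ordinal 10 4 isT) :: write_uint v
  | Decimal.D5 v => digit (@Ordinal 10 5 isT) :: write_uint v
  | Decimal.D6 v => digit (@Ordinal 10 6 isT) :: write_uint v
  | Decimal.D7 v => digit (@Ordinal 10 7 isT) :: write_uint v
  | Decimal.D8 v => digit (@Ordinal 10 8 isT) :: write_uint v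
  | Decimal.D9 v => digit (@Ordinal 10 9 isT) :: write_uint v
  end.

Definition write_nat (n : nat) : seq symbol := write_uint (Nat.to_uint n).

Definition write_var (n : nat) : seq symbol := kw KVar :: write_nat n.

Definition write_infix (s : keyword) (u v : seq symbol) : seq symbol :=
  kw KLpar :: u ++ kw s :: v ++ [:: kw KRpar].

Fixpoint write_term (t : term) : seq symbol :=
  match t with
  | Var n => write_var n
  | Zero => [:: kw KZero]
  | One => [:: kw KOne]
  | Compl t1 => kw KCompl :: write_term t1
  | Cap t1 t2 => write_infix KCap (write_term t1) (write_term t2)
  | Cup t1 t2 => write_infix KCup (write_term t1) (write_term t2)
  end.

Fixpoint write_formula (f : formula) : seq symbol :=
  match f with
  | Eq t1 t2 => write_infix KEq (write_term t1) (write_term t2)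
  | Not f1 => kw KNot :: write_formula f1
  | And f1 f2 => write_infix KAnd (write_formula f1) (write_formula f2)
  | Or f1 f2 => write_infix KOr (write_formula f1) (write_formula f2)
  | Imp f1 f2 => write_infix KImp (write_formula f1) (write_formula f2)
  | All n f1 => kw KAll :: write_var n ++ write_formula f1
  | Ex n f1 => kw KEx :: write_var n ++ write_formula f1
  end.

Definition write_action (b : action A) : symbol :=
  match b with
  | inl a => inl a
  | inr true => kw KRight
  | inr false => kw KLeft
  end.

Definition write_instruction (I : instruction A 1) : seq symbol :=
  kw KState :: write_nat I.1.1 ++ [seq inl a | a <- I.1.2]
  ++ kw KArrow
  :: kw KState :: write_nat I.2.1 ++ [seq write_action b | b <- I.2.2].

Definition write_program (P : machine A 1) : seq symbol :=
  flatten [seq rcons (write_instruction r) (kw KSemi) | r <- program P].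

Definition is_text (w : seq symbol) : Prop :=
  [\/ exists f : formula, w = write_formula f,
      exists (P : machine A 1) (I : instruction A 1),
        I \in program P /\ w = write_instruction I
    | exists P : machine A 1, w = write_program P].

(* The alphabet of the machines that translate words into codes and back. *)
Lemma joint_alphabet_uniq :
  uniq [seq (inl a : A + symbol) | a <- [:: blank A; start A; bit0 A; bit1 A]].
Proof. by rewrite map_inj_uniq ?alphabet_uniq// => a b []. Qed.

Definition joint_alphabet : alphabet := Alphabet joint_alphabet_uniq.

Definition of_code (x : seq A) : seq joint_alphabet := [seq inl a | a <- x].
Definition of_text (w : seq symbol) : seq joint_alphabet :=
  [seq inr s | s <- w].

Record encoding := Encoding {
  code :> seq symbol -> seq A;
  code_word : forall w, is_text w -> is_word (code w);
  code_ptime : exists (k : nat) (M : machine joint_alphabet k.+1)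
      (p : {poly nat}), forall w, is_text w ->
    outputs_within M [:: of_text w] (of_code (code w)) (p.[size w])%R;
  decode_ptime : exists (k : nat) (M : machine joint_alphabet k.+1)
      (p : {poly nat}), forall w, is_text w ->
    outputs_within M [:: of_code (code w)] (of_text w) (p.[size (code w)])%R;
  size_code_ge : forall w, is_text w -> size w <= size (code w);
  size_code_le : exists a b : nat, forall w, is_text w ->
    size (code w) <= a * size w + b;
  code_instruction : forall (P : machine A 1) (I : instruction A 1),
    I \in program P ->
    infix (code (write_instruction I)) (code (write_program P)) }.

Definition code_sentence (cO : encoding) (f : sentence) : seq A :=
  cO (write_formula f).

Definition code_machine (cO : encoding) (P : machine A 1) : seq A :=
  cO (write_program P).

Definition code_language (cO : encoding) (T : sentence -> Prop)
    (x : seq A) : Prop :=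
  exists2 f : sentence, T f & x = code_sentence cO f.

(* A polynomial in two variables is an element of {poly {poly nat}}, here
   evaluated at (|X|, |c_O P|); X is given on the first tape and c_O P on the
   second one. *)
Definition polytime_written (cO : encoding)
    (Omega : seq A -> machine A 1 -> sentence) : Prop :=
  exists (k : nat) (W : machine A k.+2) (g : {poly {poly nat}}),
    forall (X : seq A) (P : machine A 1), is_word X ->
      outputs_within W [:: X; code_machine cO P]
        (code_sentence cO (Omega X P))
        (g.[(size (code_machine cO P))%:P].[size X])%R.

End Writing.

(* Main.v *)
Require Import Defs.
From Stdlib Require Import DecimalNat.
From HB Require Import structures.
From mathcomp Require Import all_boot all_order all_algebra.
From mathcomp Require Import reals exp.
From mathcomp Require Import boolp zify lra.

Set Implicit Arguments.
Unset Strict Implicit.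
Unset Printing Implicit Defensive.

Import Order.TTheory GRing.Theory Num.Theory.

(** The proof is a diagonalization that uses the sentences [Omega] in place of
    a universal machine. Suppose that [M] decides the theory in the forbidden
    time, and let [W] be a machine that writes the sentences [Omega (eps / 2)].
    A one-tape machine [P] reads an input X that contains a code [w], writes the
    sentence that [W] gives for X and [w], asks [M] about it, and answers the
    opposite. For [w] the code of [P] itself, the sentence is true if and only
    if [P] accepts X within [2 ^ size X] steps. If [M] accepts the sentence,
    then [P] rejects X although the sentence says that it accepts. If [M]
    rejects it, then [P] accepts X, and as soon as it does so in time, the
    sentence is true after all.

    The bound that is assumed for [M] would be too large for the sentences of
    parameter [eps]: their length contributes the factor [size w], which would
    turn the running time into a power of [2 ^ size X]. The theorem speaks of
    all parameters, however, and the sentences of parameter [eps / 2] are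
    shorter. On them [M] takes only [2 `^ (kappa * n `^ delta)] steps up to a
    constant factor, where [n = size X], with a constant [kappa] and an exponent
    [delta = (2 + eps / 2) / (2 + eps)] below 1. The square of this, and of the
    time of [W], is below [2 ^ n] for large [n] even with a constant factor
    ([growth]), so that the simulation of [W] and [M] by one machine need not be
    efficient. The input can be made as long as wanted since it consists of [w]
    and a padding ([packed]).

    The machine [P] must have a single tape and the alphabet of [W] and [M], in
    which only three letters may be available for writing. It is built from
    procedures, finite-state programs with a result, which compose by [bind]
    and [loop] and of which [compile] makes a machine ([run_compile]). Several
    virtual tapes are laid out in columns behind the input ([rep]); reading,
    acting on one of them and fetching a letter of the input are procedures
    whose effect is proved once ([does_read], [does_act], [does_fetch_cons]).
    Everything else is a statement about the virtual tapes: a machine is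
    simulated ([does_simulate]), the input is unpacked ([does_load]), and the
    whole yields [decider_run].

    Finally, acceptance of the code of a sentence means truth of this sentence
    because codes can be decoded ([code_inj]) and formulae are uniquely
    readable ([write_formula_inj]). *)

(** * Procedures on one tape *)

Section Procedures.

Variable A : alphabet.

Implicit Types (a : A) (x y : nat) (tau : nat -> A).

Definition legal a (b : action A) : bool :=
  if b is inl c then (a != start A) && (c != start A) else true.

Definition put tau x a : nat -> A := fun y => if y == x then a else tau y.

Definition act_tape tau x (b : action A) : nat -> A :=
  if b is inl a then put tau x a else tau.

Definition act_pos x (b : action A) : nat :=
  match b with inl _ => x | inr true => x.+1 | inr false => x.-1 end.

(** A procedure is a one-tape program with a result: its finitely many states
    are anonymous, and it stops by entering a value of [R] instead of a state.
    Each procedure takes at least one step, which spares [loop] the case of a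
    body that never moves. *)
Record proc (R : finType) := Proc {
  pstate : finType;
  pinit : pstate;
  pdelta : pstate -> A -> (pstate + R) * action A }.

(** The transition function is a parameter, rather than the procedure, because
    a loop keeps it when it starts its next round, but not its initial state. *)
Inductive runs (Q R : Type) (delta : Q -> A -> (Q + R) * action A) :
    Q -> nat -> (nat -> A) -> nat -> R -> nat -> (nat -> A) -> Prop :=
| runs_stop q x tau r b :
    delta q (tau x) = (inr r, b) -> legal (tau x) b ->
    runs delta q x tau 1 r (act_pos x b) (act_tape tau x b)
| runs_step q x tau q' b t r y ups :
    delta q (tau x) = (inl q', b) -> legal (tau x) b ->
    runs delta q' (act_pos x b) (act_tape tau x b) t r y ups ->
    runs delta q x tau t.+1 r y ups.

(** The time is only bounded, so that estimates can be rounded up whenever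
    procedures are composed. *)
Definition exec (R : finType) (p : proc R) x tau T (r : R) y ups : Prop :=
  exists2 t, t <= T & runs (@pdelta R p) (pinit p) x tau t r y ups.

Lemma exec_le (R : finType) (p : proc R) x tau T T' r y ups :
  exec p x tau T r y ups -> T <= T' -> exec p x tau T' r y ups.
Proof. by case=> t tT rt TT'; exists t => //; apply: leq_trans tT TT'. Qed.

Definition atom (R : finType) (f : A -> R * action A) : proc R :=
  @Proc R unit tt (fun _ a => (inr (f a).1, (f a).2)).

Lemma exec_atom (R : finType) (f : A -> R * action A) x tau :
  legal (tau x) (f (tau x)).2 ->
  exec (atom f) x tau 1 (f (tau x)).1 (act_pos x (f (tau x)).2)
    (act_tape tau x (f (tau x)).2).
Proof. by move=> lf; exists 1 => //; exact: runs_stop. Qed.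

Definition bind (R S : finType) (p : proc R) (f : R -> proc S) : proc S :=
  @Proc S (pstate p + {r : R & pstate (f r)})%type (inl (pinit p))
    (fun q a => match q with
     | inl q => let: (o, b) := pdelta q a in
        (match o with
         | inl q' => inl (inl q')
         | inr r => inl (inr (existT (fun r => pstate (f r)) r (pinit (f r))))
         end, b)
     | inr (existT r q) => let: (o, b) := pdelta q a in
        (match o with
         | inl q' => inl (inr (existT (fun r => pstate (f r)) r q'))
         | inr s => inr s
         end, b)
     end).

Lemma runs_bindr (R S : finType) (p : proc R) (f : R -> proc S) r
    (q : pstate (f r)) x tau t s y ups :
  runs (@pdelta S (f r)) q x tau t s y ups ->
  runs (@pdelta S (bind p f)) (inr (existT (fun r => pstate (f r)) r q))
    x tau t s y ups.
Proof.
elim=> {q x tau t s y ups} [q x tau s b e l | q x tau q' b t s y ups e l _ IH].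
  by apply: runs_stop => //=; rewrite e.
by apply: runs_step IH => //=; rewrite e.
Qed.

Lemma runs_bindl (R S : finType) (p : proc R) (f : R -> proc S)
    (q : pstate p) x tau t1 r y ups t2 s z phi :
  runs (@pdelta R p) q x tau t1 r y ups ->
  runs (@pdelta S (f r)) (pinit (f r)) y ups t2 s z phi ->
  runs (@pdelta S (bind p f)) (inl q) x tau (t1 + t2) s z phi.
Proof.
elim=> {q x tau t1 r y ups}
  [q x tau r b e l | q x tau q' b t r y ups e l _ IH] run2.
  by apply: runs_step (runs_bindr p run2) => //=; rewrite e.
by rewrite addSn; apply: runs_step (IH run2) => //=; rewrite e.
Qed.

Lemma exec_bind (R S : finType) (p : proc R) (f : R -> proc S)
    x tau T1 r y ups T2 s z phi :
  exec p x tau T1 r y ups -> exec (f r) y ups T2 s z phi ->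
  exec (bind p f) x tau (T1 + T2) s z phi.
Proof.
case=> t1 le1 run1 [t2 le2 run2].
by exists (t1 + t2); [exact: leq_add | exact: runs_bindl run1 run2].
Qed.

Definition loop (S R : finType) (f : S -> proc (S + R)%type) (s : S) : proc R :=
  @Proc R {s : S & pstate (f s)}
    (existT (fun s => pstate (f s)) s (pinit (f s)))
    (fun u a => let: existT s q := u in
       let: (o, b) := pdelta q a in
       (match o with
        | inl q' => inl (existT (fun s => pstate (f s)) s q')
        | inr (inl s') => inl (existT (fun s => pstate (f s)) s' (pinit (f s')))
        | inr (inr r) => inr r
        end, b)).

Lemma exec_loop_stop (S R : finType) (f : S -> proc (S + R)%type) s
    x tau T r y ups :
  exec (f s) x tau T (inr r) y ups -> exec (loop f s) x tau T r y ups.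
Proof.
case=> t le_t run; exists t => //; rewrite [pinit _]/=.
move: (pinit (f s)) run => q; move eo: (inr r) => o run.
elim: run eo => {q x tau t le_t o y ups}
  [q x tau o b e l eo | q x tau q' b t o y ups e l _ IH eo].
  by apply: runs_stop => //=; rewrite e -eo.
by apply: runs_step (IH eo) => //=; rewrite e.
Qed.

Lemma exec_loop_next (S R : finType) (f : S -> proc (S + R)%type) s s'
    x tau T1 y ups T2 r z phi :
  exec (f s) x tau T1 (inl s') y ups -> exec (loop f s') y ups T2 r z phi ->
  exec (loop f s) x tau (T1 + T2) r z phi.
Proof.
case=> t1 le1 run1 [t2 le2 run2]; exists (t1 + t2); first exact: leq_add.
rewrite [pinit _]/=; move: (pinit (f s)) run1 => q.
move eo: (inl s') => o run1.
elim: run1 eo run2 => {q x tau t1 le1 o y ups}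
  [q x tau o b e l eo | q x tau q' b t o y ups e l _ IH eo] run2.
  by apply: runs_step run2 => //=; rewrite e -eo.
by rewrite addSn; apply: runs_step (IH eo run2) => //=; rewrite e.
Qed.

End Procedures.

Notation "r <~ p ;; q" := (bind p (fun r => q))
  (at level 90, p at level 89, q at level 90, right associativity).
Notation "p ;; q" := (bind p (fun=> q)) (at level 90, right associativity).

Section Motions.

Variable A : alphabet.

Implicit Types (a : A) (x y : nat) (tau : nat -> A).

(** Stepping to the right and back does nothing, and is legal even on the start
    symbol, which must not be rewritten by itself either. *)
Definition look : proc A A :=
  a <~ atom (fun a => (a, inr true)) ;; atom (fun=> (a, inr false)).

Lemma exec_look x tau : exec look x tau 2 (tau x) x tau.
Proof.
apply: (exec_bind (T1 := 1) (T2 := 1)); first exact: exec_atom.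
exact: (@exec_atom _ _ (fun=> (tau x, inr false))).
Qed.

Definition ret (R : finType) (r : R) : proc A R :=
  atom (fun=> (tt, inr true)) ;; atom (fun=> (r, inr false)).

Lemma exec_ret (R : finType) (r : R) x tau : exec (ret r) x tau 2 r x tau.
Proof.
apply: (exec_bind (T1 := 1) (T2 := 1)); first exact: exec_atom.
exact: (@exec_atom _ _ (fun=> (r, inr false))).
Qed.

Fixpoint go (d : bool) (n : nat) : proc A unit :=
  if n is n'.+1 then atom (fun=> (tt, inr d)) ;; go d n' else ret tt.

Lemma exec_right n x tau : exec (go true n) x tau (n + 2) tt (x + n) tau.
Proof.
elim: n x => [|n IHn] x; first by rewrite addn0; apply: exec_ret.
rewrite -(addSnnS x n); apply: exec_le.
  by apply: exec_bind; [apply: exec_atom | apply: IHn].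
lia.
Qed.

Lemma exec_left n x tau : exec (go false n) x tau (n + 2) tt (x - n) tau.
Proof.
elim: n x => [|n IHn] x; first by rewrite subn0; apply: exec_ret.
rewrite -[x - n.+1]/(x - (1 + n)) subnDA subn1; apply: exec_le.
  by apply: exec_bind; [apply: exec_atom | apply: IHn].
lia.
Qed.

Lemma exec_left_of n x y tau :
  x = y + n -> exec (go false n) x tau (n + 2) tt y tau.
Proof. by move=> ->; have := exec_left n (y + n) tau; rewrite addnK. Qed.

Definition peek (n : nat) : proc A A :=
  go true n ;; a <~ look ;; go false n ;; ret a.

Lemma exec_peek n x tau :
  exec (peek n) x tau (n.*2 + 8) (tau (x + n)) x tau.
Proof.
apply: exec_le.
  apply: exec_bind (exec_right _ _ _) _.
  apply: exec_bind (exec_look _ _) _.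
  apply: exec_bind (exec_left_of _ (erefl _)) _; exact: exec_ret.
lia.
Qed.

Definition poke (n : nat) a : proc A unit :=
  go true n ;; atom (fun=> (tt, inl a)) ;; go false n.

Lemma exec_poke n a x tau : tau (x + n) != start A -> a != start A ->
  exec (poke n a) x tau (n.*2 + 5) tt x (put tau (x + n) a).
Proof.
move=> na nb; apply: exec_le.
  apply: exec_bind (exec_right _ _ _) _.
  apply: exec_bind; last exact: exec_left_of.
  by apply: (@exec_atom _ _ (fun=> (tt, inl a))); rewrite /= na.
lia.
Qed.

Definition seek (test : proc A bool) (move : proc A unit) : proc A unit :=
  loop (fun=> b <~ test ;; if b then ret (inr tt)
              else move ;; ret (inl tt : unit + unit)%type) tt.

(** [f] lists the positions at which the search makes its test. *)
Lemma exec_seek (test : proc A bool) (move : proc A unit) (f : nat -> nat) n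
    T1 T2 tau :
  (forall i, i <= n -> exec test (f i) tau T1 (i == n) (f i) tau) ->
  (forall i, i < n -> exec move (f i) tau T2 tt (f i.+1) tau) ->
  exec (seek test move) (f 0) tau (n.+1 * (T1 + T2 + 2)) tt (f n) tau.
Proof.
move=> et em.
suff H i k : i + k = n ->
    exec (seek test move) (f i) tau (k.+1 * (T1 + T2 + 2)) tt (f n) tau.
  exact: H.
elim: k i => [|k IHk] i.
  rewrite addn0 => ->; apply: exec_le.
    apply: exec_loop_stop; apply: exec_bind; first exact: et.
    rewrite /=.
    rewrite eqxx; exact: exec_ret.
  lia.
rewrite addnS -addSn => ik; apply: exec_le.
  apply: exec_loop_next _ (IHk _ ik); apply: exec_bind; first by apply: et; lia.
  rewrite ifF; last lia.
  by apply: exec_bind; [apply: em; lia | exact: exec_ret].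
lia.
Qed.

End Motions.

Arguments go : simpl never.

(** * From procedures to machines *)

Section Compilation.

Variables (A : alphabet) (p : proc A bool).

(** The numbers 1 and 2 are kept for the results true and false, which thus
    become acceptance and rejection. *)
Definition state_code (q : pstate p) : nat :=
  if q == pinit p then 0 else (enum_rank q).+3.

Definition outcome_code (o : pstate p + bool) : nat :=
  match o with inl q => state_code q | inr b => if b then 1 else 2 end.

Lemma state_code_inj : injective state_code.
Proof.
move=> q q'; rewrite /state_code.
case: eqP => [->|_]; case: eqP => [->|_] // [].
by move/ord_inj/enum_rank_inj.
Qed.

Definition proc_instruction (qa : pstate p * A) : instruction A 1 :=
  ((state_code qa.1, [tuple qa.2]),
   (outcome_code (pdelta qa.1 qa.2).1, [tuple (pdelta qa.1 qa.2).2])).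

Definition proc_program : seq (instruction A 1) :=
  [seq proc_instruction qa | qa <- enum {: pstate p * A}
                           & legal qa.2 (pdelta qa.1 qa.2).2].

Lemma proc_program_uniq : uniq [seq r.1 | r <- proc_program].
Proof.
rewrite -map_comp map_inj_uniq; first exact/filter_uniq/enum_uniq.
by move=> [q a] [q' a'] /= [] /state_code_inj -> ->.
Qed.

Lemma proc_program_start : all (@preserves_start A 1) proc_program.
Proof.
apply/allP => r /mapP[[q a]]; rewrite mem_filter => /andP[+ _] -> {r}.
rewrite /preserves_start /=; case: pdelta => o b /= l; apply/forallP => i.
by rewrite !(tnth_nth b) !(tnth_nth a) (ord1 i) /=; case: b l.
Qed.

Definition compile : machine A 1 :=
  Machine proc_program_uniq proc_program_start.

End Compilation.

(** The first instruction that applies to a configuration is the only one. *)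
Lemma uniq_key_filter (T1 T2 : eqType) (s : seq (T1 * T2)) r :
  uniq [seq r.1 | r <- s] -> r \in s -> [seq r' <- s | r'.1 == r.1] = [:: r].
Proof.
elim: s => //= r' s IHs /andP[nr us]; rewrite inE => /predU1P[->|rs].
  rewrite eqxx; congr cons; apply/eqP.
  rewrite -[_ == _]negbK -has_filter.
  by apply: contra nr => /hasP[r'' rs /eqP <-]; apply: map_f.
by rewrite ifF ?IHs //; apply: contraNF nr => /eqP ->; apply: map_f.
Qed.

Definition config_of (A : alphabet) q x (tau : nat -> A) : config A 1 :=
  Config q (fun=> x) (fun=> tau).

Lemma runS (A : alphabet) k (M : machine A k) t c :
  run M t.+1 c = run M t (step M c).
Proof. by rewrite /run iterSr. Qed.

Lemma step_compile (A : alphabet) (p : proc A bool) q x tau :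
  let: (o, b) := pdelta q (tau x) in
  legal (tau x) b ->
  step (compile p) (config_of (state_code q) x tau)
    = config_of (@outcome_code A p o) (act_pos x b) (act_tape tau x b).
Proof.
case e : (pdelta q (tau x)) => [o b] l; rewrite /step ifF; last first.
  by rewrite /accepting /rejecting /= /state_code; case: ifP.
have -> : (state (config_of (state_code q) x tau),
           scanned (config_of (state_code q) x tau))
    = (proc_instruction (q, tau x)).1 :> nat * 1.-tuple A.
  by congr pair; apply/val_inj; rewrite /= enum_ordSl enum_ord0.
rewrite uniq_key_filter ?proc_program_uniq //=.
  rewrite e /= /apply_actions /config_of /=.
  congr Config; apply: funext => i.
    by rewrite (ord1 i) (tnth_nth b) /=; case: b {e l} => // -[].
  by rewrite (ord1 i) (tnth_nth b) /=; case: b {e l}.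
apply/mapP; exists (q, tau x) => //.
by rewrite mem_filter /= e l mem_enum.
Qed.

Lemma run_compile (A : alphabet) (p : proc A bool) q x tau t b y ups :
  runs (@pdelta A bool p) q x tau t b y ups ->
  state (run (compile p) t (config_of (state_code q) x tau))
    = if b then 1 else 2.
Proof.
elim=> {q x tau t b y ups} [q x tau b c e l | q x tau q' c t b y ups e l _ <-].
  by have := step_compile q x tau; rewrite runS e => ->.
by have := step_compile q x tau; rewrite runS e => ->.
Qed.

(** * Virtual tapes *)

Lemma letters_neq (A : alphabet) :
  ((blank A == start A) = false) * ((bit1 A == start A) = false)
  * ((bit0 A == start A) = false) * ((bit1 A == blank A) = false)
  * ((blank A == bit1 A) = false) * ((bit0 A == blank A) = false)
  * ((bit0 A == bit1 A) = false) * ((start A == blank A) = false).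
Proof.
have := alphabet_uniq A; rewrite /= !inE !negb_or -!andbA.
case/and5P=> b1 b2 b3 b4 /and3P[b5 b6 _].
by do !split; apply/negbTE => //; rewrite eq_sym.
Qed.

Section VirtualTapes.

Variables (A : alphabet) (K n : nat).

Record vstate := VState {
  hd : 'I_K -> nat;
  tp : 'I_K -> nat -> A;
  inp : seq A }.

Implicit Types (s : vstate) (tau : nat -> A) (a : A) (i : 'I_K).

Definition width := (2 * K).+1.
Definition column p := n.+2 + p * width.

(** The tape holds, from left to right: the start symbol, the part of the
    input that is still unread, flush right against cell [n], a blank, and then
    one column for each position of the virtual tapes. A column consists of a
    flag that is set at position 0 only, of one mark for each tape, set where
    its head is, and of one letter for each tape. The start symbols of the
    virtual tapes are not written, since the flag stands for them. *)
Record rep (s : vstate) (tau : nat -> A) : Prop := Rep {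
  rep_start : tau 0 = start A;
  rep_size : size (inp s) <= n;
  rep_inp : forall x, x <= n -> tau x.+1 =
    if x < n - size (inp s) then blank A
    else nth (blank A) (inp s) (x - (n - size (inp s)));
  rep_flag : forall p, tau (column p) = if p == 0 then bit1 A else blank A;
  rep_mark : forall p (i : 'I_K),
    tau (column p + i.+1) = if p == hd s i then bit1 A else blank A;
  rep_letter : forall p (i : 'I_K), 0 < p ->
    tau (column p + (K + i).+1) = tp s i p;
  rep_word : is_word (inp s);
  rep_left : forall i, tp s i 0 = start A;
  rep_right : forall p i, 0 < p -> tp s i p != start A }.

Lemma column0 : column 0 = n.+2.
Proof. by rewrite /column mul0n addn0. Qed.

Lemma columnS p : column p.+1 = column p + width.
Proof. by rewrite /column mulSn; lia. Qed.

(** Cells of different tracks or columns do not interfere. *)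
Lemma eq_column p q r r' : r < width -> r' < width ->
  (column p + r == column q + r') = (p == q) && (r == r').
Proof.
move=> rw rw'; rewrite /column -!addnA eqn_add2l.
apply/eqP/andP => [e|[/eqP -> /eqP ->] //].
have w0 : 0 < width by [].
have: (p * width + r) %/ width = (q * width + r') %/ width by rewrite e.
have: (p * width + r) %% width = (q * width + r') %% width by rewrite e.
by rewrite !modnMDl !modn_small // !divnMDl // !divn_small // !addn0 => -> ->.
Qed.

Definition to_head (i : 'I_K) : proc A unit :=
  seek (a <~ peek A i.+1 ;; ret A (a == bit1 A)) (go A true width).

Definition to_base : proc A unit :=
  seek (a <~ look A ;; ret A (a != blank A)) (go A false width).

Definition local (i : 'I_K) (b : action A) : proc A unit :=
  match b with
  | inl a => poke (K + i).+1 a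
  | inr true => poke i.+1 (blank A) ;; go A true width ;; poke i.+1 (bit1 A)
  | inr false => f <~ look A ;;
     if f == blank A then
       poke i.+1 (blank A) ;; go A false width ;; poke i.+1 (bit1 A)
     else ret A tt
  end.

Definition vact (s : vstate) (i : 'I_K) (b : action A) : vstate :=
  VState (fun j => if j == i then act_pos (hd s i) b else hd s j)
         (fun j => if j == i then act_tape (tp s i) (hd s i) b else tp s j)
         (inp s).

Definition vdo i b : proc A unit := to_head i ;; local i b ;; to_base.

Definition vread (i : 'I_K) : proc A A :=
  to_head i ;; f <~ look A ;;
  a <~ (if f == blank A then peek A (K + i).+1 else ret A (start A)) ;;
  to_base ;; ret A a.

Definition in_input a : bool := (a != blank A) && (a != start A).

(** The unread input is consumed from its left end. *)
Definition fetch : proc A (option A) :=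
  go A false 2 ;; a <~ look A ;;
  if in_input a then
    seek (a <~ look A ;; ret A (~~ in_input a)) (go A false 1) ;;
    go A true 1 ;;
    b <~ atom (fun a : A => (a, inl (blank A) : action A)) ;;
    go A true 1 ;;
    seek (a <~ look A ;; ret A (a == blank A)) (go A true 1) ;;
    go A true 1 ;; ret A (Some b)
  else go A true 2 ;; ret A None.

Lemma exec_to_head s tau i : rep s tau ->
  exec (to_head i) (column 0) tau ((hd s i).+1 * (15 * width)) tt
    (column (hd s i)) tau.
Proof.
move=> rs; apply: exec_le.
  apply: exec_seek => [p le_p|p lt_p].
    apply: exec_bind; first exact: exec_peek.
    rewrite (rep_mark rs).
    have -> : ((if p == hd s i then bit1 A else blank A) == bit1 A)
        = (p == hd s i).
      by case: (p =P _) => _; rewrite ?eqxx ?letters_neq.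
    exact: exec_ret.
  rewrite columnS; exact: exec_right.
apply: leq_mul => //; have := ltn_ord i; rewrite /width; lia.
Qed.

Lemma exec_to_base s tau p : rep s tau ->
  exec to_base (column p) tau (p.+1 * (15 * width)) tt (column 0) tau.
Proof.
move=> rs; apply: exec_le.
  rewrite -(subnn p) -[X in exec _ (column X)](subn0 p).
  apply: (exec_seek (f := fun k => column (p - k))) => k le_k.
    apply: exec_bind; first exact: exec_look.
    rewrite (rep_flag rs) subn_eq0.
    have -> : ((if p <= k then bit1 A else blank A) != blank A) = (k == p).
      by rewrite eqn_leq le_k; case: leqP => _; rewrite ?eqxx ?letters_neq.
    exact: exec_ret.
  apply: exec_left_of; rewrite -columnS; congr column; lia.
apply: leq_mul => //; rewrite /width; lia.
Qed.

(** [15 * width] steps take a search across one column. An operation searches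
    its head and comes back, and what it does at the head is worth two columns,
    so that three crossings pay for it. *)
Definition cost := 45 * width.

(** [does p s N r s'] charges [p] with [N] virtual operations; each of them
    is paid by the farthest position that a head may have reached by the end.
    The bound thus is quadratic in [N], but the counts of consecutive procedures
    add up. The hypothesis [n <= m] serves [fetch], which crosses the input. *)
Record does (R : finType) (p : proc A R) s N (r : R) s' : Prop := Does {
  does_run : forall m tau, n <= m -> (forall i, hd s i <= m) -> rep s tau ->
    exists tau', [/\ exec p (column 0) tau (N * (cost * (m + N).+1)) r
                       (column 0) tau',
                     rep s' tau' & forall i, hd s' i <= m + N] }.

Lemma does_le (R : finType) (p : proc A R) s N N' r s' :
  does p s N r s' -> N <= N' -> does p s N' r s'.
Proof.
move=> ds le; split=> m tau nm hm rs.
have [tau' [e rs' hm']] := does_run ds nm hm rs.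
exists tau'; split=> // [|i]; last by apply: leq_trans (hm' i) _; lia.
apply: exec_le e _; apply: leq_mul => //; apply: leq_mul => //; lia.
Qed.

Lemma paid N1 N2 m :
  N1 * (cost * (m + N1).+1) + N2 * (cost * (m + N1 + N2).+1)
    <= (N1 + N2) * (cost * (m + (N1 + N2)).+1).
Proof.
rewrite mulnDl leq_add //; last by rewrite addnA.
by rewrite leq_mul // leq_mul //; lia.
Qed.

Lemma does_bind (R S : finType) (p : proc A R) (f : R -> proc A S)
    s1 N1 r s2 N2 r' s3 :
  does p s1 N1 r s2 -> does (f r) s2 N2 r' s3 ->
  does (bind p f) s1 (N1 + N2) r' s3.
Proof.
move=> d1 d2; split=> m tau nm hm rs.
have [tau1 [e1 rs1 hm1]] := does_run d1 nm hm rs.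
have [|tau2 [e2 rs2 hm2]] := does_run d2 (m := m + N1) _ hm1 rs1; first lia.
exists tau2; split=> // [|i]; last by rewrite addnA.
apply: exec_le (exec_bind e1 e2) _; exact: paid.
Qed.

Lemma does_loop_next (S R : finType) (f : S -> proc A (S + R)%type) q q'
    s1 N1 s2 N2 r s3 :
  does (f q) s1 N1 (inl q') s2 -> does (loop f q') s2 N2 r s3 ->
  does (loop f q) s1 (N1 + N2) r s3.
Proof.
move=> d1 d2; split=> m tau nm hm rs.
have [tau1 [e1 rs1 hm1]] := does_run d1 nm hm rs.
have [|tau2 [e2 rs2 hm2]] := does_run d2 (m := m + N1) _ hm1 rs1; first lia.
exists tau2; split=> // [|i]; last by rewrite addnA.
apply: exec_le (exec_loop_next e1 e2) _; exact: paid.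
Qed.

Lemma does_loop_stop (S R : finType) (f : S -> proc A (S + R)%type) q
    s1 N r s2 :
  does (f q) s1 N (inr r) s2 -> does (loop f q) s1 N r s2.
Proof.
move=> d; split=> m tau nm hm rs.
have [tau1 [e1 rs1 hm1]] := does_run d nm hm rs.
by exists tau1; split=> //; apply: exec_loop_stop.
Qed.

Lemma does_ret (R : finType) (r : R) s : does (ret A r) s 1 r s.
Proof.
split=> m tau nm hm rs; exists tau; split=> // [|i]; last by have := hm i; lia.
apply: exec_le (exec_ret _ _ _) _; rewrite mul1n.
by apply: leq_trans (leq_pmulr _ _) => //; rewrite /cost /width; lia.
Qed.

Lemma paid_op h h' x m : h <= m -> h' <= m.+1 -> x <= 30 * width ->
  h.+1 * (15 * width) + (x + h'.+1 * (15 * width)) <= 1 * (cost * (m + 1).+1).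
Proof.
move=> hm hm' xw.
have -> : 1 * (cost * (m + 1).+1)
    = m.+1 * (15 * width) + (m.+1 * (30 * width) + 45 * width).
  by rewrite /cost mul1n addn1 mulnC mulSn addnA -mulnDr -mulnDl addnC.
apply: leq_add; first by rewrite leq_mul.
have : h'.+1 * (15 * width) <= m.+2 * (15 * width) by rewrite leq_mul.
rewrite !(mulSn m.+1) !(mulSn m) !(mulnCA m); lia.
Qed.

Lemma does_read i s : does (vread i) s 1 (tp s i (hd s i)) s.
Proof.
split=> m tau nm hm rs; exists tau; split=> // [|j]; last by have := hm j; lia.
apply: exec_le.
  apply: exec_bind; first exact: exec_to_head rs.
  apply: exec_bind; first exact: exec_look.
  apply: exec_bind; last first.
    apply: exec_bind; first exact: (exec_to_base (hd s i) rs).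
    exact: exec_ret.
  rewrite (rep_flag rs); case: posnP => [h0|h0].
    rewrite letters_neq h0 (rep_left rs).
    apply: exec_le; first exact: exec_ret.
    exact: (leq_addr (15 * width)).
  rewrite eqxx -(rep_letter rs) //; apply: exec_le; first exact: exec_peek.
  have := ltn_ord i; rewrite /width; lia.
apply: leq_trans (paid_op (x := 15 * width + 6) (hm i) (leqW (hm i)) _).
  set w := width; lia.
rewrite /width; lia.
Qed.

Lemma put_column tau p q r r' a : r < width -> r' < width ->
  put tau (column q + r) a (column p + r')
    = if (p == q) && (r' == r) then a else tau (column p + r').
Proof. by move=> rw rw'; rewrite /put eq_column. Qed.

Lemma put_low tau q r a x : x < n.+2 -> put tau (column q + r) a x = tau x.
Proof. by move=> xn; rewrite /put ifF // /column; lia. Qed.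

Lemma mark_track (i : 'I_K) : i.+1 < width.
Proof. by have := ltn_ord i; rewrite /width; lia. Qed.

Lemma letter_track (i : 'I_K) : (K + i).+1 < width.
Proof. by have := ltn_ord i; rewrite /width; lia. Qed.

(** Position 0 is excluded since its letter is not stored but implied by the
    flag. *)
Lemma rep_write s tau i a : rep s tau -> 0 < hd s i -> a != start A ->
  rep (vact s i (inl a)) (put tau (column (hd s i) + (K + i).+1) a).
Proof.
move=> [r0 rn ri rf rm rl rw rL rR] h0 na; split=> //.
- by move=> x xn; rewrite put_low ?ri.
- move=> p; rewrite -[column p]addn0 put_column ?letter_track //.
  by rewrite andbF addn0.
- move=> p j; rewrite put_column ?letter_track ?mark_track //.
  rewrite ifF ?rm /=; last first.
    by apply/negbTE; rewrite negb_and; apply/orP; right; have := ltn_ord j; lia.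
  by case: (j =P i) => // ->.
- move=> p j p0; rewrite put_column ?letter_track //= eqSS eqn_add2l.
  case: (j =P i) => [->|/eqP ji] /=; last first.
    by rewrite ifF ?rl //; apply/negbTE; rewrite negb_and ji orbT.
  by rewrite eqxx andbT /put; case: eqP => // _; rewrite rl.
- move=> j /=; case: eqP => // _; rewrite /put; case: eqP => // e; lia.
- move=> p j p0 /=; case: (j =P i) => [_|_]; last exact: rR.
  by rewrite /put; case: (p =P _) => // _; apply: rR.
Qed.

Lemma rep_move s s' tau i h : rep s tau ->
  (forall j, hd s' j = if j == i then h else hd s j) ->
  (forall j, tp s' j = tp s j) -> inp s' = inp s ->
  rep s' (put (put tau (column (hd s i) + i.+1) (blank A))
              (column h + i.+1) (bit1 A)).
Proof.
move=> [r0 rn ri rf rm rl rw rL rR] eh et ei; split; rewrite ?ei //.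
- by move=> x xn; rewrite !put_low ?ri.
- move=> p; rewrite -[column p]addn0 !put_column ?mark_track //.
  by rewrite !andbF addn0.
- move=> p j; rewrite !put_column ?mark_track // !eqSS eh rm.
  case: (j =P i) => [->|/eqP ji].
    by rewrite eqxx !andbT; case: (p == h) => //; case: (p == hd s i).
  have -> : ((j : nat) == i) = false by apply/negbTE.
  by rewrite !andbF.
- move=> p j p0; rewrite !put_column ?letter_track ?mark_track // !eqSS et.
  have -> : (K + j == i) = false by have := ltn_ord i; lia.
  by rewrite !andbF rl.
- by move=> j; rewrite et.
- by move=> p j p0; rewrite et; apply: rR.
Qed.

Lemma vact_move_tp s i d j : tp (vact s i (inr d)) j = tp s j.
Proof. by rewrite /=; case: eqP => // ->. Qed.

Lemma does_act i b s : legal (tp s i (hd s i)) b ->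
  does (vdo i b) s 1 tt (vact s i b).
Proof.
move=> lb; split=> m tau nm hm rs.
have pb : act_pos (hd s i) b <= m.+1.
  by have := hm i; case: b lb => [a|[]] _ /=; lia.
have hm' j : hd (vact s i b) j <= m + 1.
  by rewrite /= addn1; case: eqP => // _; have := hm j; lia.
suff [tau' [e rs']] : exists tau',
    exec (local i b) (column (hd s i)) tau (15 * width) tt
      (column (act_pos (hd s i) b)) tau'
    /\ rep (vact s i b) tau'.
  exists tau'; split=> //; apply: exec_le.
    apply: exec_bind; first exact: exec_to_head rs.
    apply: exec_bind; first exact: e.
    exact: (exec_to_base _ rs').
  apply: paid_op => //; set w := width; lia.
have iK := ltn_ord i.
have marks p : tau (column p + i.+1) != start A.
  by rewrite (rep_mark rs); case: ifP => _; rewrite letters_neq.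
case: b lb {pb hm'} => [a /andP[na sa]|[] _].
- have h0 : 0 < hd s i.
    by rewrite lt0n; apply: contraNneq na => ->; rewrite (rep_left rs).
  exists (put tau (column (hd s i) + (K + i).+1) a).
  split; last exact: rep_write.
  apply: exec_le; first by apply: exec_poke; rewrite ?(rep_letter rs).
  rewrite /width; lia.
- eexists; split.
    apply: exec_le.
      apply: exec_bind; first by apply: exec_poke; rewrite ?letters_neq.
      apply: exec_bind; first exact: exec_right.
      rewrite -columnS; apply: exec_poke; rewrite ?letters_neq //.
      by rewrite put_column ?mark_track // ifF // gtn_eqF.
    rewrite /width; lia.
  by apply: rep_move => // j; rewrite vact_move_tp.
(* A head at position 0 stays, as on a tape of its own. *)
case: (posnP (hd s i)) => [h0|h0].
  have -> : vact s i (inr false) = s.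
    case: s h0 {hm rs marks} => h t v /= h0; rewrite /vact /=.
    by congr VState; apply: funext => j; case: eqP => // ->; rewrite ?h0.
  exists tau; split=> //=; rewrite h0; apply: exec_le.
    apply: exec_bind; first exact: exec_look.
    rewrite (rep_flag rs) letters_neq; exact: exec_ret.
  rewrite /width; lia.
have e : column (hd s i) = column (hd s i).-1 + width.
  by rewrite -columnS prednK.
eexists; split.
  apply: exec_le.
    apply: exec_bind; first exact: exec_look.
    rewrite (rep_flag rs) gtn_eqF // eqxx.
    apply: exec_bind; first by apply: exec_poke; rewrite ?letters_neq.
    apply: exec_bind; first exact: (exec_left_of _ e).
    apply: exec_poke; rewrite ?letters_neq //.
    by rewrite put_column ?mark_track // ifF // ltn_eqF // prednK.
  rewrite /width; lia.
by apply: rep_move => // j; rewrite vact_move_tp.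
Qed.

Lemma exec_test x tau b (test : pred A) : test (tau x) = b ->
  exec (a <~ look A ;; ret A (test a)) x tau 4 b x tau.
Proof.
by move=> <-; apply: (exec_bind (T1 := 2) (T2 := 2));
  [exact: exec_look | exact: exec_ret].
Qed.

Lemma does_fetch_nil s : inp s = [::] -> does fetch s 1 None s.
Proof.
move=> s0; split=> m tau nm hm rs; exists tau.
split=> // [|i]; last by have := hm i; lia.
apply: exec_le.
  apply: exec_bind; first exact: exec_left.
  apply: exec_bind; first exact: exec_look.
  rewrite ifF.
    apply: exec_bind; last exact: exec_ret.
    have -> : column 0 = column 0 - 2 + 2 by rewrite column0; lia.
    rewrite addnK; exact: exec_right.
  rewrite column0 subn2 /= /in_input; case en : n => [|n'].
    by rewrite (rep_start rs) eqxx andbF.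
  by rewrite (rep_inp rs) ?en // s0 subn0 ltnS leqnn eqxx.
rewrite mul1n; apply: leq_trans (leq_pmulr _ _) => //.
rewrite /cost /width; lia.
Qed.

Lemma does_fetch_cons s a v : inp s = a :: v ->
  does fetch s 1 (Some a) (VState (hd s) (tp s) v).
Proof.
move=> sa; split=> m tau nm hm rs.
have [r0 rn ri rf rm rl rw rL rR] := rs.
move: rn ri rw; rewrite sa /= => vn ri /andP[/andP[ab as0] vw].
(* d letters have been consumed so far *)
have [d nE] : exists d, n = d + (size v).+1.
  by exists (n - (size v).+1); rewrite subnK.
have dE : n - (size v).+1 = d by rewrite nE addnK.
rewrite dE in ri.
have letterE j : j <= size v -> tau (d + j).+1 = nth (blank A) (a :: v) j.
  by move=> jv; rewrite ri ?[(_ < _)%N]ltnNge ?leq_addr /= ?addKn //; lia.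
have letter_in j : j <= size v -> in_input (tau (d + j).+1).
  move=> jv; rewrite letterE //; case: j jv => [|j] jv.
    by rewrite /in_input ab.
  exact: (allP vw _ (mem_nth _ jv)).
have left_out : in_input (tau d) = false.
  rewrite /in_input; case ed : d => [|d']; first by rewrite r0 eqxx andbF.
  by rewrite ri ?ed ?ltnSn ?eqxx //; lia.
exists (put tau d.+1 (blank A)).
split=> [||i]; last by have := hm i; rewrite /=; lia.
  apply: exec_le.
    apply: exec_bind; first exact: exec_left.
    rewrite column0 subn2 /=.
    apply: exec_bind; first exact: exec_look.
    have tn : tau n = tau (d + size v).+1 by rewrite nE addnS.
    rewrite tn letter_in // -{1}[n]subn0.
    apply: exec_bind.
      apply: (exec_seek (f := fun k => n - k) (n := (size v).+1)) => k kv.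
        apply: (exec_test (test := fun a => ~~ in_input a)).
        case: (k =P _) => [->|/eqP ne]; first by rewrite dE left_out.
        have -> : n - k = (d + (size v - k)).+1 by lia.
        by rewrite letter_in ?leq_subr.
      apply: exec_left_of; lia.
    rewrite dE; apply: exec_bind; first exact: exec_right.
    rewrite addn1; apply: exec_bind.
      by apply: exec_atom; rewrite /= -[d]addn0 letterE //= as0 letters_neq.
    rewrite /= -[X in tau X.+1]addn0 letterE //=.
    apply: exec_bind; first exact: exec_right.
    rewrite addn1 -[d.+2]addn0; apply: exec_bind.
      apply: (exec_seek (f := fun k => d.+2 + k) (n := size v)) => k kv.
        apply: (exec_test (test := fun a => a == blank A)).
        rewrite /put ifF; last lia.
        have -> : d.+2 + k = (d + k.+1).+1 by lia.
        rewrite ri; last by lia.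
        rewrite ltnNge leq_addr /= addKn /=.
        case: (k =P _) => [->|/eqP ne]; first by rewrite nth_default ?eqxx.
        have kv' : k < size v by rewrite ltn_neqAle ne.
        by have := allP vw _ (mem_nth (blank A) kv') => /andP[/negbTE].
      have -> : d.+2 + k.+1 = d.+2 + k + 1 by lia.
      exact: exec_right.
    apply: exec_bind; last exact: exec_ret.
    have -> : n.+2 = d.+2 + size v + 1 by lia.
    exact: exec_right.
  have w1 : m.+2 <= width * m.+2 by rewrite leq_pmull.
  rewrite mul1n /cost addn1 -mulnA; lia.
split=> //=.
- by rewrite ltnW.
- move=> x xn; rewrite /put eqSS.
  have -> : n - size v = d.+1 by rewrite nE; lia.
  case: (ltngtP x d) => [xd|xd|->]; last by rewrite ltnSn.
    by rewrite ltnS ltnW // ri // xd.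
  rewrite ltnS leqNgt xd /= ri // ltnNge (ltnW xd) /=.
  by rewrite -(subnSK xd).
- by move=> p; rewrite /put ifF ?rf // /column; lia.
- by move=> p i; rewrite /put ifF ?rm // /column; lia.
- by move=> p i p0; rewrite /put ifF ?rl // /column; lia.
Qed.

End VirtualTapes.

(** * Simulation of a machine with several tapes *)

Section Simulation.

Variables (A : alphabet) (K n : nat) (k : nat) (M : machine A k).
Variables (emb : 'I_k -> 'I_K) (emb_inj : injective emb).

Implicit Types (s : vstate A K) (c : config A k).

Fixpoint reads (l : seq 'I_k) (f : {ffun 'I_k -> A}) :
    proc A {ffun 'I_k -> A} :=
  if l is i :: l' then
    a <~ vread A (emb i) ;; reads l' [ffun j => if j == i then a else f j]
  else ret A f.

Lemma does_reads l f s : does n (reads l f) s (size l).+1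
  [ffun j => if j \in l then tp s (emb j) (hd s (emb j)) else f j] s.
Proof.
elim: l f => [|i l IHl] f.
  have -> : [ffun j => if j \in [::] then tp s (emb j) (hd s (emb j))
                       else f j] = f.
    by apply/ffunP => j; rewrite ffunE.
  exact: does_ret.
apply: (does_bind (N1 := 1)); first exact: does_read.
have -> : [ffun j => if j \in i :: l then tp s (emb j) (hd s (emb j)) else f j]
  = [ffun j => if j \in l then tp s (emb j) (hd s (emb j))
     else [ffun j => if j == i then tp s (emb i) (hd s (emb i)) else f j] j].
  apply/ffunP => j; rewrite !ffunE inE.
  by case: eqP => [->|//]; rewrite if_same.
exact: IHl.
Qed.

Fixpoint acts (l : seq 'I_k) (b : k.-tuple (action A)) : proc A unit :=
  if l is i :: l' then vdo (emb i) (tnth b i) ;; acts l' b else ret A tt.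

Definition vacts (l : seq 'I_k) (b : k.-tuple (action A)) s : vstate A K :=
  foldl (fun s i => vact s (emb i) (tnth b i)) s l.

Lemma does_acts l b s : uniq l ->
  (forall i, i \in l -> legal (tp s (emb i) (hd s (emb i))) (tnth b i)) ->
  does n (acts l b) s (size l).+1 tt (vacts l b s).
Proof.
elim: l s => [|i l IHl] s /=; first by move=> _ _; apply: does_ret.
move=> /andP[il ul] leg; apply: (does_bind (N1 := 1)).
  by apply: does_act; apply: leg; rewrite inE eqxx.
apply: IHl => // j jl; rewrite /= !ifF ?leg ?inE ?jl ?orbT //.
all: by apply: contraNF il => /eqP/emb_inj <-.
Qed.

Lemma vacts_in l b s i : uniq l ->
  hd (vacts l b s) (emb i)
    = (if i \in l then act_pos (hd s (emb i)) (tnth b i) else hd s (emb i)) /\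
  tp (vacts l b s) (emb i)
    = (if i \in l then act_tape (tp s (emb i)) (hd s (emb i)) (tnth b i)
       else tp s (emb i)).
Proof.
elim: l s => [|j l IHl] s //= /andP[jl ul].
have [-> ->] := IHl (vact s (emb j) (tnth b j)) ul.
rewrite inE /= (inj_eq emb_inj); case: eqP => [->|//] /=.
by rewrite (negbTE jl).
Qed.

Definition tracks s c : Prop :=
  forall i, hd s (emb i) = pos c i /\ tp s (emb i) = cell c i.

(** The tapes that a simulated machine does not use keep their contents, and so
    remain fresh for the next machine. *)
Definition same_outside s s' : Prop :=
  inp s' = inp s /\
  forall j, (forall i, emb i != j) -> hd s' j = hd s j /\ tp s' j = tp s j.

Lemma vacts_outside l b s : same_outside s (vacts l b s).
Proof.
elim: l s => [|i l IHl] s //=; have [e f] := IHl (vact s (emb i) (tnth b i)).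
split=> // j nj; have [-> ->] := f j nj.
by rewrite /= eq_sym (negbTE (nj i)).
Qed.

Definition max_state : nat :=
  (\max_(r <- program M) maxn r.1.1 r.2.1).+2.

(** The state of [M] is kept in the control of the procedure, which is finite:
    no state above [max_state] can be reached from one below it. *)
Definition sim_body (q : 'I_max_state.+1) :
    proc A ('I_max_state.+1 + bool)%type :=
  if q == 1 :> nat then ret A (inr true)
  else if q == 2 :> nat then ret A (inr false)
  else
    f <~ reads (enum 'I_k) [ffun=> blank A] ;;
    if [seq r.2 | r <- program M & r.1 == (q : nat, [tuple f i | i < k])]
      is r :: _
    then acts (enum 'I_k) r.2 ;; ret A (inl (inord r.1))
    else ret A (inl q).

Lemma state_step c : state c <= max_state -> state (step M c) <= max_state.
Proof.
move=> cm; rewrite /step; case: ifP => // _.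
case E : [seq _ | _ <- _ & _] => [//|r l] /=.
have : r \in r :: l by rewrite inE eqxx.
rewrite -E => /mapP[r' + ->]; rewrite mem_filter => /andP[_ r'M].
have := leq_bigmax_seq
  (F := fun r : instruction A k => maxn r.1.1 r.2.1) r' r'M isT.
by move/(leq_trans (leq_maxr _ _))/leq_trans; apply; rewrite ltnW.
Qed.

Lemma sim_step s c : state c <= max_state -> tracks s c ->
  ~~ (accepting c || rejecting c) ->
  exists s', [/\ does n (sim_body (inord (state c))) s (2 * k + 3)
                   (inl (inord (state (step M c)))) s',
                 tracks s' (step M c) & same_outside s s'].
Proof.
move=> cm tr; rewrite /sim_body /step inordK // /accepting /rejecting => na.
rewrite (negbTE na); move: na; rewrite negb_or => /andP[/negbTE -> /negbTE ->].
pose f := [ffun j => tp s (emb j) (hd s (emb j))].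
have dr : does n (reads (enum 'I_k) [ffun=> blank A]) s k.+1 f s.
  have := does_reads (enum 'I_k) [ffun=> blank A] s.
  rewrite size_enum_ord; congr does; apply/ffunP => j.
  by rewrite !ffunE mem_enum.
have sc : [tuple f i | i < k] = scanned c.
  apply: eq_from_tnth => i; rewrite !tnth_mktuple ffunE.
  by have [-> ->] := tr i.
case E : [seq _ | _ <- _ & _] => [|r l].
  exists s; split=> //; apply: does_le.
    by apply: does_bind dr _; rewrite sc E; apply: does_ret.
  lia.
exists (vacts (enum 'I_k) r.2 s); split; last exact: vacts_outside.
  apply: does_le.
    apply: does_bind dr _; rewrite sc E.
    apply: does_bind; last exact: does_ret.
    apply: does_acts => [|i _]; first exact: enum_uniq.
    have : r \in r :: l by rewrite inE eqxx.
    rewrite -E => /mapP[r' + ->]; rewrite mem_filter => /andP[/eqP e r'M].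
    case: M r'M => prog u ps /= r'M.
    have /forallP/(_ i) := allP ps _ r'M.
    rewrite e /= tnth_mktuple; have [-> ->] := tr i.
    by case: (tnth r'.2.2 i).
  rewrite size_enum_ord; lia.
move=> i; have [-> ->] := vacts_in r.2 s i (enum_uniq 'I_k).
rewrite mem_enum /=; have [-> ->] := tr i; split=> //.
by apply: funext => x; case: (tnth r.2 i).
Qed.

Definition simulate : proc A bool := loop sim_body (inord 0).

Lemma run_halted t c : accepting c || rejecting c -> run M t c = c.
Proof. by move=> h; elim: t => //= t ->; rewrite /step h. Qed.

Lemma does_simulate t s c : state c = 0 -> tracks s c ->
  accepting (run M t c) || rejecting (run M t c) ->
  exists s', [/\ does n simulate s (t.+1 * (2 * k + 3))
                   (accepting (run M t c)) s',
                 tracks s' (run M t c) & same_outside s s'].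
Proof.
move=> c0; have : state c <= max_state by rewrite c0.
rewrite /simulate.
have -> : inord 0 = inord (state c) :> 'I_max_state.+1 by rewrite c0.
elim: t s c {c0} => [|t IHt] s c cm tr h.
  exists s; split=> //; apply: (does_le (N := 1)); last lia.
  apply: does_loop_stop; rewrite /sim_body inordK //.
  move: h; rewrite /accepting /rejecting /=; case: eqP => //= _.
    by move=> _; apply: does_ret.
  by move=> ->; apply: does_ret.
have [hc|hc] := boolP (accepting c || rejecting c).
  have := IHt s c cm tr; rewrite !run_halted // => /(_ hc) [s' [d tr' so]].
  by exists s'; split=> //; apply: does_le d _; rewrite leq_mul2r leqnSn orbT.
have [s1 [d1 tr1 so1]] := sim_step cm tr hc.
rewrite runS in h *.
have [s' [d tr' so]] := IHt s1 _ (state_step cm) tr1 h.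
exists s'; split=> //.
  by rewrite (mulSn t.+1); apply: does_loop_next d1 d.
split=> [|j nj]; first by rewrite so.1 so1.1.
by have [-> ->] := so.2 j nj; apply: so1.2.
Qed.

Lemma pos_run t c i : pos (run M t c) i <= pos c i + t.
Proof.
elim: t => [|t IHt]; first by rewrite addn0.
rewrite /= addnS; apply: (@leq_trans (pos (run M t c) i).+1) => //.
rewrite /step; case: ifP => // _; case: [seq _ | _ <- _ & _] => //= r _.
case: (tnth r.2 i) => // -[] //; exact: leq_trans (leq_pred _) _.
Qed.

End Simulation.

(** * Reading a packed input *)

Section Loading.

Variables (A : alphabet) (K n : nat).

Implicit Types (s : vstate A K) (i j : 'I_K) (w u v : seq A).

(** The invariants of the representation may be assumed of the virtual state
    before any procedure. *)
Lemma does_rep R (p : proc A R) s N r s' :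
  (forall tau, rep n s tau -> does n p s N r s') -> does n p s N r s'.
Proof.
move=> d; split=> m tau nm hm rs.
by have [/(_ m)] := d tau rs; apply.
Qed.

Definition rewind i : proc A unit :=
  loop (fun=> a <~ vread A i ;;
    if a == start A then ret A (inr tt)
    else vdo i (inr false : action A) ;; ret A (inl tt : unit + unit)%type) tt.

Lemma does_rewind i s : does n (rewind i) s ((hd s i).+1 * 3) tt
  (VState (fun j => if j == i then 0 else hd s j) (tp s) (inp s)).
Proof.
apply: does_rep => tau [_ _ _ _ _ _ _ left right].
have {tau left} left : tp s i 0 = start A by [].
have {}right p : 0 < p -> tp s i p != start A by move=> p0; apply: right.
move eh : (hd s i) => h; elim: h s eh left right => [|h IHh] s eh left right.
  have -> : VState (fun j => if j == i then 0 else hd s j) (tp s) (inp s) = s.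
    case: s eh {left right} => h t v /= e; congr VState.
    by apply: funext => j; case: eqP => // ->.
  apply: (does_le (N := 1 + 1)) => //; apply: does_loop_stop.
  apply: does_bind; first exact: does_read.
  by rewrite eh left eqxx; apply: does_ret.
apply: (does_le (N := 1 + (1 + 1) + h.+1 * 3)); last lia.
apply: (does_loop_next (s2 := vact s i (inr false))).
  apply: does_bind; first exact: does_read.
  rewrite eh (negbTE (right _ _)) //.
  by apply: does_bind; [apply: does_act | apply: does_ret].
have := IHh (vact s i (inr false)).
rewrite /= eqxx eh /= => /(_ erefl left right).
rewrite -/(rewind i); congr does; congr VState; apply: funext => j /=.
  by case: (j =P i) => // ->.
by case: (j =P i) => // ->.
Qed.

Lemma tape_of_rcons w (a : A) :
  tape_of (rcons w a) = put (tape_of w) (size w).+1 a.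
Proof.
apply: funext => x; rewrite /tape_of /put -rcons_cons nth_rcons /=.
by case: (ltngtP x (size w).+1) => [xw|xw|_] //; rewrite nth_default //= ltnW.
Qed.

Lemma tape_of_default w x : size w < x -> tape_of w x = blank A.
Proof. by move=> wx; rewrite /tape_of nth_default. Qed.

(** The heads stand on the last letters, so that a letter is appended by a move
    to the right and a write. *)
Definition words (ws : 'I_K -> seq A) v : vstate A K :=
  VState (fun i => size (ws i)) (fun i => tape_of (ws i)) v.

Definition push i (a : A) : proc A unit :=
  vdo i (inr true : action A) ;; vdo i (inl a : action A).

Lemma does_push i a ws v : a != start A ->
  does n (push i a) (words ws v) 2 tt
    (words (fun j => if j == i then rcons (ws i) a else ws j) v).
Proof.
move=> na; apply: (does_bind (N1 := 1) (N2 := 1)); first exact: does_act.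
have -> : words (fun j => if j == i then rcons (ws i) a else ws j) v
    = vact (vact (words ws v) i (inr true)) i (inl a).
  congr VState; apply: funext => j; rewrite /= ?eqxx; case: (j =P i) => // _.
    by rewrite size_rcons.
  by rewrite tape_of_rcons.
by apply: does_act; rewrite /= eqxx tape_of_default // letters_neq.
Qed.

(** A self-delimiting code: each letter of [w] is announced by a 1, and the
    first 0 ends [w]. The padding makes the input as long as wanted. *)
Definition packed w m : seq A :=
  flatten [seq [:: bit1 A; a] | a <- w] ++ nseq m.+1 (bit0 A).

Lemma packed_word w m : is_word w -> is_word (packed w m).
Proof.
rewrite /is_word /packed all_cat all_nseq !letters_neq orbT andbT.
by elim: w => //= a w IHw /andP[-> /IHw ->]; rewrite !letters_neq.
Qed.

Lemma size_packed w m : size (packed w m) = (size w).*2 + m.+1.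
Proof.
rewrite /packed size_cat size_nseq; congr addn.
by elim: w => //= a w ->.
Qed.

Variables (i0 i1 : 'I_K) (distinct : i0 != i1).

(** [Some true] expects an announcement, [Some false] a letter of the packed
    word, and [None] padding. *)
Definition load_body (o : option bool) : proc A (option bool + unit)%type :=
  c <~ fetch A ;;
  if c is Some a then
    push i0 a ;;
    match o with
    | None => ret A (inl None)
    | Some true => ret A (inl (if a == bit1 A then Some false else None))
    | Some false => push i1 a ;; ret A (inl (Some true))
    end
  else ret A (inr tt).

Definition on_two u0 u1 : 'I_K -> seq A :=
  fun j => if j == i0 then u0 else if j == i1 then u1 else [::].

Definition two_words u0 u1 v : vstate A K := words (on_two u0 u1) v.

Lemma does_push0 a u0 u1 v : a != start A ->
  does n (push i0 a) (two_words u0 u1 v) 2 tt (two_words (rcons u0 a) u1 v).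
Proof.
move=> na; have := does_push i0 (on_two u0 u1) v na.
have -> : on_two u0 u1 i0 = u0 by rewrite /on_two eqxx.
congr does; congr words; apply: funext => j.
by rewrite /on_two; case: (j =P i0).
Qed.

Lemma does_push1 a u0 u1 v : a != start A ->
  does n (push i1 a) (two_words u0 u1 v) 2 tt (two_words u0 (rcons u1 a) v).
Proof.
move=> na; have := does_push i1 (on_two u0 u1) v na.
have -> : on_two u0 u1 i1 = u1.
  by rewrite /on_two eqxx eq_sym (negbTE distinct).
congr does; congr words.
apply: funext => j; rewrite /on_two.
by case: (j =P i1) => // ->; rewrite eq_sym (negbTE distinct).
Qed.

Lemma does_load_padding u0 u1 v : is_word v ->
  does n (loop load_body None) (two_words u0 u1 v) (4 * size v + 2) tt
    (two_words (u0 ++ v) u1 [::]).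
Proof.
elim: v u0 => [|a v IHv] u0.
  move=> _; rewrite cats0; apply: does_loop_stop.
  by apply: (does_bind (N1 := 1)); [apply: does_fetch_nil | apply: does_ret].
move=> /andP[/andP[_ na] vw].
apply: (does_le (N := 1 + (2 + 1) + (4 * size v + 2))); last by rewrite /=; lia.
rewrite -cat_rcons; apply: does_loop_next (IHv _ vw).
apply: does_bind; first exact: does_fetch_cons.
by apply: does_bind; [apply: does_push0 | apply: does_ret].
Qed.

Lemma does_load w m u0 u1 : is_word w ->
  does n (loop load_body (Some true)) (two_words u0 u1 (packed w m))
    (6 * size (packed w m) + 2) tt
    (two_words (u0 ++ packed w m) (u1 ++ w) [::]).
Proof.
elim: w u0 u1 => [|a w IHw] u0 u1.
  move=> _; rewrite cats0 /packed /=.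
  pose N := 4 * size (nseq m (bit0 A)) + 2.
  apply: (does_le (N := 1 + (2 + 1) + N)); last by rewrite /N; lia.
  rewrite -cat_rcons; apply: does_loop_next; last first.
    by apply: does_load_padding; rewrite /is_word all_nseq !letters_neq orbT.
  apply: does_bind; first exact: does_fetch_cons.
  apply: does_bind; first by apply: does_push0; rewrite letters_neq.
  rewrite letters_neq; exact: does_ret.
move=> /andP[/andP[_ na] ww].
pose N := 6 * size (packed w m) + 2.
apply: (does_le (N := 1 + (2 + 1) + (1 + (2 + (2 + 1)) + N))).
  rewrite -[packed (a :: w) m]/(bit1 A :: a :: packed w m) -!cat_rcons.
  apply: does_loop_next.
    apply: does_bind; first exact: does_fetch_cons.
    apply: does_bind; first by apply: does_push0; rewrite letters_neq.
    rewrite eqxx; exact: does_ret.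
  apply: does_loop_next (IHw _ _ ww).
  apply: does_bind; first exact: does_fetch_cons.
  apply: does_bind; first by apply: does_push0.
  by apply: does_bind; [apply: does_push1 | apply: does_ret].
rewrite /N !size_packed /=; lia.
Qed.

End Loading.

(** * Laying out the virtual tapes *)

Section Setup.

Variables (A : alphabet) (K : nat).

Fixpoint set_marks (l : seq 'I_K) : proc A unit :=
  if l is i :: l' then poke i.+1 (bit1 A) ;; set_marks l' else ret A tt.

Lemma exec_set_marks l x (tau : nat -> A) :
  (forall i : 'I_K, tau (x + i.+1) != start A) ->
  exec (set_marks l) x tau (size l * (2 * K + 5) + 2) tt x
    (fun y => if has (fun i : 'I_K => y == x + i.+1) l then bit1 A else tau y).
Proof.
elim: l tau => [|i l IHl] tau ns; first exact: exec_ret.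
apply: exec_le.
  apply: exec_bind; first by apply: exec_poke; rewrite ?ns ?letters_neq.
  have -> : (fun y => if has (fun i : 'I_K => y == x + i.+1) (i :: l)
                      then bit1 A else tau y)
    = (fun y => if has (fun i : 'I_K => y == x + i.+1) l then bit1 A
                else put tau (x + i.+1) (bit1 A) y).
    by apply: funext => y; rewrite /= /put; case: eqP => //= _; rewrite if_same.
  by apply: IHl => j; rewrite /put; case: ifP => // _; rewrite letters_neq.
have := ltn_ord i; rewrite /=; lia.
Qed.

(** Only the column of position 0 has to be written: a blank column has no flag
    and no mark, and its letters are blank. *)
Definition setup : proc A unit :=
  go A true 1 ;;
  seek (a <~ look A ;; ret A (a == blank A)) (go A true 1) ;;
  go A true 1 ;; poke 0 (bit1 A) ;; set_marks (enum 'I_K).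

Lemma exec_setup (X : seq A) : is_word X -> exists tau : nat -> A,
  exec setup 0 (tape_of X) (9 * size X + (K * (2 * K + 5) + 40)) tt
    (column K (size X) 0) tau /\
  rep (size X) (words (fun=> [::] : seq A) X : vstate A K) tau.
Proof.
move=> Xw; pose n := size X.
have low x : x < n -> tape_of X x.+1 != blank A.
  by move=> xn; have /andP[] := allP Xw _ (mem_nth (blank A) xn).
have high x : n < x -> tape_of X x = blank A by exact: tape_of_default.
eexists; split.
  apply: exec_le.
    apply: exec_bind; first exact: exec_right.
    rewrite add0n -[1]addn0; apply: exec_bind.
      apply: (exec_seek (f := fun k => 1 + k) (n := n)) => k kn.
        apply: (exec_test (test := fun a => a == blank A)).
        case: (k =P n) => [->|/eqP ne]; first by rewrite high ?eqxx.
        by rewrite (negbTE (low _ _)) // ltn_neqAle ne.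
      have -> : 1 + k.+1 = 1 + k + 1 by lia.
      exact: exec_right.
    apply: exec_bind; first exact: exec_right.
    have -> : 1 + n + 1 = column K n 0 by rewrite column0; lia.
    apply: exec_bind.
      apply: exec_poke; rewrite ?letters_neq //.
      by rewrite addn0 column0 high // letters_neq.
    rewrite addn0; apply: exec_set_marks => i.
    by rewrite /put ifF ?high ?letters_neq ?column0 //; lia.
  rewrite size_enum_ord -/n; lia.
have marked q r : r < width K ->
    has (fun i : 'I_K => column K n q + r == column K n 0 + i.+1) (enum 'I_K)
      = (q == 0) && (0 < r <= K).
  move=> rw; apply/hasP/idP => [[i _]|/and3P[/eqP -> r0 rK]].
    by rewrite eq_column ?mark_track // => /andP[-> /eqP ->] /=; apply: ltn_ord.
  have rK' : r.-1 < K by rewrite prednK.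
  by exists (Ordinal rK'); rewrite ?mem_enum //= prednK.
have lower y : y < n.+2 ->
    has (fun i : 'I_K => y == column K n 0 + i.+1) (enum 'I_K) = false.
  by move=> yn; apply/hasP => -[i _ /eqP]; rewrite column0; lia.
split=> //=.
- by rewrite lower.
- move=> x xn; rewrite lower // /put ifF ?column0; last lia.
  by rewrite subnn subn0.
- move=> q; have := marked q 0 isT; rewrite addn0 => ->; rewrite andbF.
  rewrite /put -[column K n 0]addn0 -[column K n q]addn0 eq_column // andbT.
  by case: eqP => // _; rewrite high // addn0 /column; lia.
- move=> q i; rewrite marked ?mark_track //= ltn_ord andbT.
  case: eqP => // _; rewrite /put -[column K n 0]addn0.
  rewrite eq_column ?mark_track // andbF.
  by rewrite high // /column; lia.
- move=> q i q0; rewrite marked ?letter_track // gtn_eqF //=.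
  rewrite /put -[column K n 0]addn0 eq_column ?letter_track // gtn_eqF //=.
  by rewrite high ?tape_of_default // /column; lia.
- by move=> q i q0; rewrite tape_of_default ?letters_neq.
Qed.

End Setup.

(** * The diagonal machine *)

Section Negation.

Variables (A : alphabet) (kW kM : nat).
Variables (W : machine A kW.+2) (M : machine A kM.+1).

Local Notation K := (kW.+2 + kM.+1).

(** [M] finds its input where [W] leaves its output; its other tapes must be
    fresh. *)
Definition tape_W (i : 'I_kW.+2) : 'I_K := lshift kM.+1 i.
Definition tape_M (i : 'I_kM.+1) : 'I_K :=
  if i == ord0 then tape_W ord0 else rshift kW.+2 i.

Lemma tape_M_inj : injective tape_M.
Proof.
move=> i j; rewrite /tape_M /tape_W.
case: eqP => [->|_]; case: eqP => [->|_] //.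
exact: rshift_inj.
Qed.

Definition tape_input : 'I_K := tape_W ord0.
Definition tape_code : 'I_K := tape_W (lift ord0 ord0).

(** [W] expects its whole input on its first tape and the word unpacked from it
    on its second one. *)
Definition decide_negation : proc A bool :=
  loop (load_body A tape_input tape_code) (Some true) ;;
  rewind A tape_input ;; rewind A tape_code ;;
  simulate W tape_W ;; rewind A tape_input ;;
  b <~ simulate M tape_M ;; ret A (~~ b).

Definition steps := 2 * kW + 2 * kM + 60.

Lemma does_decide_negation n w m out tW tM : let X := packed w m in
  is_word w -> outputs_within W [:: X; w] out tW ->
  let final := run M tM (initial kM.+1 [:: out]) in
  accepting final || rejecting final ->
  exists s, does n decide_negation (words (fun=> [::]) X : vstate A K)
              (steps * (size X + tW + tM).+1) (~~ accepting final) s.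
Proof.
move=> X ww [t tle [acc outE]] final halt.
have distinct : tape_input != tape_code.
  by rewrite /tape_input /tape_code (inj_eq (@lshift_inj _ _)).
set s0 := two_words tape_input tape_code X w [::].
have dl : does n (loop (load_body A tape_input tape_code) (Some true))
    (words (fun=> [::]) X : vstate A K) (6 * size X + 2) tt s0.
  have := does_load n distinct m [::] [::] ww; congr does.
  rewrite /two_words; congr words; apply: funext => j.
  by rewrite /on_two !if_same.
have d0 := does_rewind n tape_input s0.
have d1 := does_rewind n tape_code
  (VState (fun j => if j == tape_input then 0 else hd s0 j)
     (tp s0) [::]).
move: d1; set s1 := (X in does _ _ _ _ _ X) => d1.
have hd1 j : hd s1 j = 0.
  rewrite /s1 /s0 /= /on_two; case: (j =P tape_code) => // _.
  by case: (j =P tape_input).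
have tp1 j : tp s1 j = tape_of (on_two tape_input tape_code X w j) by [].
have tr1 : tracks tape_W s1 (initial kW.+2 [:: X; w]).
  move=> i; rewrite hd1 tp1; split=> //=.
  rewrite /on_two !(inj_eq (@lshift_inj _ _)); congr tape_of.
  case: i => -[|[|i]] ilt //=; by rewrite nth_nil.
have haltW : accepting (run W t (initial kW.+2 [:: X; w]))
    || rejecting (run W t (initial kW.+2 [:: X; w])) by rewrite acc.
have [s2 [d2 tr2 so2]] := does_simulate n (@lshift_inj _ _)
  (erefl : state (initial kW.+2 [:: X; w]) = 0) tr1 haltW.
have d3 := does_rewind n tape_input s2.
move: d3; set s3 := (X in does _ _ _ _ _ X) => d3.
have hd3 j : hd s3 j = if j == tape_input then 0 else hd s2 j by [].
have tr3 : tracks tape_M s3 (initial kM.+1 [:: out]).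
  move=> j; rewrite /tape_M; case: (j =P ord0) => [->|/eqP j0].
    rewrite hd3 eqxx; split=> //; have [_ tp3] := tr2 ord0.
    rewrite -[tp s3]/(tp s2) tp3; exact: funext outE.
  have out_j i : tape_W i != rshift kW.+2 j by rewrite /tape_W eq_lrshift.
  have [e1 e2] := so2.2 (rshift kW.+2 j) out_j.
  have n0 : (rshift kW.+2 j == tape_input) = false.
    by rewrite /tape_input /tape_W eq_rlshift.
  have n1 : (rshift kW.+2 j == tape_code) = false.
    by rewrite /tape_code /tape_W eq_rlshift.
  rewrite hd3 n0 e1 hd1 -[tp s3]/(tp s2) e2 tp1 /on_two n0 n1; split=> //.
  by case: j j0 {out_j e1 e2 n0 n1} => -[|j] jlt // _; rewrite /= nth_nil.
have [s4 [d4 _ _]] := does_simulate n tape_M_inj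
  (erefl : state (initial kM.+1 [:: out]) = 0) tr3 halt.
exists s4; apply: does_le.
  apply: does_bind dl _; apply: does_bind d0 _; apply: does_bind d1 _.
  apply: does_bind d2 _; apply: does_bind d3 _; apply: does_bind d4 _.
  exact: does_ret.
have hd2 : hd s2 tape_input <= t.
  by have [-> _] := tr2 ord0; apply: pos_run.
set T := size X + tW + tM.
have hX : hd s0 tape_input = size X by [].
have hw : hd (VState (fun j => if j == tape_input then 0 else hd s0 j)
     (tp s0) [::]) tape_code = size w by [].
have le_w : size w <= size X by rewrite size_packed; lia.
have sW : t.+1 * (2 * kW.+2 + 3) <= T.+1 * (2 * kW + 7).
  by apply: leq_mul; rewrite /T; lia.
have sM : tM.+1 * (2 * kM.+1 + 3) <= T.+1 * (2 * kM + 5).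
  by apply: leq_mul; rewrite /T; lia.
have -> : steps * T.+1 = T.+1 * (2 * kW + 7) + T.+1 * (2 * kM + 5) + 48 * T.+1.
  rewrite (mulnC steps) (mulnC 48) -!mulnDr.
  by congr muln; rewrite /steps; lia.
rewrite hX hw; move: sW sM; rewrite /T; lia.
Qed.

Definition decider : proc A bool := setup A K ;; decide_negation.

Definition overhead := steps * (cost K * steps.+1) + (K * (2 * K + 5) + 49).

Lemma decider_run w m out tW tM : let X := packed w m in
  is_word w -> outputs_within W [:: X; w] out tW ->
  let final := run M tM (initial kM.+1 [:: out]) in
  accepting final || rejecting final ->
  exists2 t, t <= overhead * (size X + tW + tM).+1 ^ 2 &
    state (run (compile decider) t (initial 1 [:: X]))
      = if accepting final then 2 else 1.
Proof.
move=> X ww outW final halt.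
have [s ds] := does_decide_negation (size X) ww outW halt.
have [tau [e0 rs]] := exec_setup K (packed_word m ww).
have [//|tau' [e1 _ _]] := does_run ds (leqnn _) _ rs.
have [t tle run_t] := exec_bind (f := fun=> decide_negation) e0 e1.
exists t; last first.
  have := run_compile run_t; rewrite if_neg => <-; congr (state (run _ _ _)).
  rewrite /initial /config_of; congr Config.
  by apply: funext => i; rewrite (ord1 i).
apply: leq_trans tle _; rewrite -/X -/final.
set T := (size X + tW + tM).+1.
rewrite /overhead (mulnDl (steps * _)) [leqRHS]addnC leq_add //; last first.
  have -> : steps * (cost K * steps.+1) * T ^ 2
    = steps * T * (cost K * (steps.+1 * T)) by lia.
  apply: leq_mul => //; apply: leq_mul => //; rewrite mulSn /T; lia.
rewrite -mulnn mulnA.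
apply: (@leq_trans ((K * (2 * K + 5) + 49) * T)); last exact: leq_pmulr.
set c := K * (2 * K + 5); rewrite /T; nia.
Qed.

End Negation.

(** * Growth *)

(** By induction on [d], for all [C] at once: with [k = h./2], a factor
    [k.+1 <= 2 ^ k] is split off, and the rest is at most [2 ^ k] as well. *)
Lemma monomial_exp C d : exists N, forall h, N <= h -> C * h.+1 ^ d <= 2 ^ h.
Proof.
elim: d C => [|d IHd] C.
  exists C => h le_h; rewrite muln1; apply: leq_trans le_h _.
  exact/ltnW/ltn_expl.
have [N HN] := IHd (C * 2 ^ d.+1); exists N.*2.+1 => h le_h.
have hE : h = odd h + (h./2).*2 by rewrite odd_double_half.
have le_k : N <= h./2 by lia.
apply: (@leq_trans (C * (2 * (h./2).+1) ^ d.+1)).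
  by rewrite leq_mul2l leq_exp2r //; apply/orP; right; lia.
rewrite expnMn mulnA (expnSr (h./2).+1) mulnA.
apply: (@leq_trans (2 ^ h./2 * 2 ^ h./2)).
  by rewrite leq_mul ?HN //; apply: ltn_expl.
by rewrite -expnD leq_exp2l //; lia.
Qed.

Lemma poly_monomial (q : {poly nat}) :
  exists C d, forall n, (q.[n])%R <= C * n.+1 ^ d.
Proof.
elim/poly_ind: q => [|q c [C [d Hq]]].
  by exists 0, 0 => n; rewrite horner0.
exists (C + c), d.+1 => n; rewrite hornerMXaddC.
rewrite -[leqLHS]/((q.[n])%R * n + c) mulnDl leq_add //.
  by rewrite expnSr mulnA leq_mul.
by rewrite leq_pmulr ?expn_gt0.
Qed.

Lemma poly_exp (q : {poly nat}) :
  exists N, forall n, N <= n -> (q.[n])%R <= 2 ^ (n %/ 4).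
Proof.
have [C [d Hq]] := poly_monomial q.
have [N HN] := monomial_exp (C * 4 ^ d) d.
exists (4 * N) => n le_n; apply: leq_trans (Hq n) _.
apply: (@leq_trans (C * (4 * (n %/ 4).+1) ^ d)).
  case: d {Hq HN} => [|d] //.
  by rewrite leq_mul2l leq_exp2r //; apply/orP; right; lia.
by rewrite expnMn mulnA HN //; lia.
Qed.

Section Growth.

Local Open Scope ring_scope.

Variable R : realType.

(** [n = n `^ (1 - delta) * n `^ delta], and the first factor exceeds any
    constant. *)
Lemma sublinear (kappa delta : R) : delta < 1 ->
  exists N, forall n, (N <= n)%N -> kappa * n%:R `^ delta <= (n %/ 4)%:R.
Proof.
move=> delta1; pose b := (8 * `|kappa| + 1) `^ (1 - delta)^-1.
exists (Num.bound `|b| + 8)%N => n le_n.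
have n0 : (0 : R) < n%:R by rewrite ltr0n; lia.
have bn : b <= n%:R.
  apply: (le_trans (ler_norm _)); apply: ltW.
  apply: (lt_le_trans (archi_boundP (normr_ge0 b))).
  by rewrite ler_nat; exact: leq_trans (leq_addr _ _) le_n.
have k8 : 8 * `|kappa| <= n%:R `^ (1 - delta).
  have d1 : 0 < 1 - delta by rewrite subr_gt0.
  apply: (@le_trans _ _ (8 * `|kappa| + 1)); first by rewrite lerDl.
  have k0 : 0 <= 8 * `|kappa| + 1 by rewrite addr_ge0 ?mulr_ge0.
  have -> : 8 * `|kappa| + 1 = b `^ (1 - delta).
    by rewrite -powRrM mulVf ?powRr1 // lt0r_neq0.
  by apply: ge0_ler_powR; rewrite ?nnegrE ?powR_ge0 // ltW.
have n8 : n%:R <= 8 * (n %/ 4)%:R :> R.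
  by rewrite -natrM ler_nat; lia.
rewrite -(ler_pM2l (_ : 0 < 8)) //; apply: le_trans n8.
rewrite mulrA; apply: (@le_trans _ _ (n%:R `^ (1 - delta) * n%:R `^ delta)).
  rewrite ler_wpM2r ?powR_ge0 //; apply: le_trans k8.
  by rewrite ler_wpM2l // ler_norm.
rewrite -powRD; last by rewrite (lt0r_neq0 n0) implybT.
by rewrite subrK powRr1 // ltW.
Qed.

(** A quarter of the exponent is enough for each of the polynomial and of the
    subexponential term. Squaring the sum doubles this, and the constants fit
    into a third quarter. *)
Lemma growth (a : nat) (q : {poly nat}) (c kappa delta : R) : delta < 1 ->
  exists N, forall n t : nat, (N <= n)%N ->
    t%:R <= c * 2 `^ (kappa * n%:R `^ delta) ->
    (a * (n + q.[n] + t).+1 ^ 2 <= 2 ^ n)%N.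
Proof.
move=> /(sublinear kappa)[N1 H1].
have [N2 H2] := poly_exp ('X + q + 1).
pose C := Num.bound `|c|; pose B := (a * C.+1 ^ 2)%N.
exists (N1 + N2 + 4 * B)%N => n t le_n le_t.
have le_q : ((n + q.[n]).+1 <= 2 ^ (n %/ 4))%N.
  have /H2 : (N2 <= n)%N by lia.
  rewrite !hornerE -[leqLHS]/(n + q.[n] + 1)%N addn1. exact.
have {}le_t : (t <= C * 2 ^ (n %/ 4))%N.
  rewrite -(ler_nat R) natrM natrX; apply: le_trans le_t _.
  apply: (@le_trans _ _ (`|c| * 2 `^ (kappa * n%:R `^ delta))).
    by rewrite ler_wpM2r ?powR_ge0 // ler_norm.
  apply: ler_pM; rewrite ?powR_ge0 //; first by exact/ltW/archi_boundP.
  by rewrite -powR_mulrn //; apply: ler_powR; rewrite ?ler1n // H1 //; lia.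
apply: (@leq_trans (a * (C.+1 * 2 ^ (n %/ 4)) ^ 2)).
  rewrite leq_mul2l leq_exp2r //; apply/orP; right.
  rewrite mulSn -addSn; exact: leq_add.
rewrite expnMn mulnA -/B -expnM.
apply: (@leq_trans (2 ^ (n %/ 4) * 2 ^ (n %/ 4 * 2))); last first.
  by rewrite -expnD leq_exp2l //; lia.
rewrite leq_mul2r; apply/orP; right.
apply: leq_trans (ltnW (ltn_expl _ _)) => //; lia.
Qed.

End Growth.

(** * Unique decoding *)

(** A word ends at the first blank of its tape. *)
Lemma tape_of_inj (A : alphabet) (u v : seq A) :
  is_word u -> is_word v -> tape_of u =1 tape_of v -> u = v.
Proof.
move=> uw vw e.
have size_le (x y : seq A) : is_word x -> tape_of x =1 tape_of y ->
    size x <= size y.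
  move=> xw xy; rewrite leqNgt; apply/negP => lt_yx.
  have /andP[/negP[]] := allP xw _ (mem_nth (blank A) lt_yx).
  by rewrite -[nth _ _ _]/(tape_of x (size y).+1) xy tape_of_default.
apply: (@eq_from_nth _ (blank A)) => [|i _]; last exact: (e i.+1).
by apply/eqP; rewrite eqn_leq !size_le // => x; rewrite e.
Qed.

Lemma run_after_halt (A : alphabet) k (M : machine A k) c t t' :
  accepting (run M t c) || rejecting (run M t c) -> t <= t' ->
  run M t' c = run M t c.
Proof.
move=> halt le_t; rewrite -(subnK le_t) /run iterD -/(run M t c).
exact: run_halted.
Qed.

(** Codes can be told apart because they can be decoded. *)
Lemma code_inj (A : alphabet) (cO : encoding A) w w' :
  is_text w -> is_text w' -> cO w = cO w' -> w = w'.
Proof.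
move=> tw tw' e; have [k [M [p dec]]] := decode_ptime cO.
have [t _ [acc out]] := dec _ tw.
have [t' _ [acc' out']] := dec _ tw'.
have text_word (u : seq (symbol A)) : is_word (of_text u).
  by rewrite /is_word all_map; apply/allP => x _.
have inr_inj : injective (inr : symbol A -> joint_alphabet A) by move=> x y [].
apply: (inj_map inr_inj); apply: tape_of_inj; rewrite ?text_word //.
move=> x; rewrite -[tape_of _ _]out -[tape_of _ _]out'.
rewrite -e in acc' out' *.
have [le_t|/ltnW le_t] := leqP t t'.
  by rewrite (run_after_halt _ le_t) ?acc.
by rewrite (run_after_halt _ le_t) ?acc'.
Qed.

(** * Unique readability *)

Section Readability.

Variable A : alphabet.

Implicit Types (u v w : seq (symbol A)).

(** What follows a numeral must not prolong it. *)
Definition no_digit w : bool := if w is inr (inl _) :: _ then false else true.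

Lemma write_uint_inj d d' u v : no_digit u -> no_digit v ->
  write_uint A d ++ u = write_uint A d' ++ v -> d = d' /\ u = v.
Proof.
move=> nu nv.
elim: d d' => [|d IH|d IH|d IH|d IH|d IH|d IH|d IH|d IH|d IH|d IH];
  case=> [|d'|d'|d'|d'|d'|d'|d'|d'|d'|d'] //= e;
  by [move: nu; rewrite e | move: nv; rewrite -e | case: e => /IH[-> ->]].
Qed.

Lemma write_nat_inj n n' u v : no_digit u -> no_digit v ->
  write_nat A n ++ u = write_nat A n' ++ v -> n = n' /\ u = v.
Proof.
move=> nu nv /(write_uint_inj nu nv)[e ->]; split=> //.
by rewrite -(Unsigned.of_to n) e Unsigned.of_to.
Qed.

Lemma write_infix_cat s u v w :
  write_infix s u v ++ w
    = kw A KLpar :: u ++ (kw A s :: v ++ (kw A KRpar :: w)).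
Proof. by rewrite /write_infix /= -!catA /= -catA. Qed.

Lemma write_term_inj t t' u v : no_digit u -> no_digit v ->
  write_term A t ++ u = write_term A t' ++ v -> t = t' /\ u = v.
Proof.
elim: t t' u v => [n|||t IH|t1 IH1 t2 IH2|t1 IH1 t2 IH2]
  [n'|||t'|t1' t2'|t1' t2'] u v nu nv; rewrite ?write_infix_cat //= => -[] //.
- by move=> /(write_nat_inj nu nv)[-> ->].
- by move=> /(IH _ _ _ nu nv)[-> ->].
- by move=> /IH1[] // -> [] /IH2[] // -> [].
- by move=> /IH1[].
- by move=> /IH1[].
- by move=> /IH1[] // -> [] /IH2[] // -> [].
Qed.

(** A term and a formula may begin with the same parentheses. After the last of
    them comes an operation between terms in the one case, and in the other an
    equation, a negation or a quantifier. *)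
Lemma write_term_formula t f u v :
  write_term A t ++ u <> write_formula A f ++ v.
Proof.
elim: t f u v => [n|||t IH|t1 IH1 t2 IH2|t1 IH1 t2 IH2]
  [s1 s2|f|f1 f2|f1 f2|f1 f2|n' f|n' f] u v;
  rewrite ?write_infix_cat //= => -[].
all: by [move=> /write_term_inj[] | move=> /IH1].
Qed.

Lemma write_formula_inj f g u v :
  write_formula A f ++ u = write_formula A g ++ v -> f = g /\ u = v.
Proof.
have no_digit_formula h w : no_digit (write_formula A h ++ w) by case: h.
elim: f g u v =>
  [s1 s2|f IH|f1 IH1 f2 IH2|f1 IH1 f2 IH2|f1 IH1 f2 IH2|n f IH|n f IH]
  [t1 t2|g|g1 g2|g1 g2|g1 g2|n' g|n' g] u v;
  rewrite ?write_infix_cat //= => -[]; rewrite -?catA //.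
all: try by [move=> /write_term_formula | move=> /esym/write_term_formula].
all: try by move=> /IH1[] // -> [] // /IH2[] // -> [].
- by move=> /write_term_inj[] // -> [] /write_term_inj[] // -> [].
- by move=> /IH[-> ->].
- by move=> /write_nat_inj[] // -> /IH[-> ->].
- by move=> /write_nat_inj[] // -> /IH[-> ->].
Qed.

End Readability.

(** * The lower bound *)

Lemma entails_Th (f : sentence) : entails (Th two_BA) f <-> Th two_BA f.
Proof. by split=> [h | h S hS]; [apply: h | apply: hS]. Qed.

Lemma code_languageE (A : alphabet) (cO : encoding A) (f : sentence) :
  code_language cO (Th two_BA) (code_sentence cO f) <-> Th two_BA f.
Proof.
split=> [[g Tg /code_inj e]|]; last by exists f.
have [|e' _] := @write_formula_inj A f g [::] [::]; last first.
  by rewrite /Th /models e'.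
by rewrite !cats0; apply: e; constructor; [exists f | exists g].
Qed.

Local Open Scope ring_scope.

Theorem corollary2 (R : realType) (A : alphabet) (cO : encoding A)
    (D : R -> R) (Omega : R -> seq A -> machine A 1 -> sentence)
    (D_gt0 : forall eps : R, 0 < eps -> 0 < D eps)
    (Omega_written : forall eps : R, 0 < eps ->
      polytime_written cO (Omega eps))
    (Omega_correct : forall eps : R, 0 < eps ->
      forall (P : machine A 1) (X : seq A), is_word X ->
        entails (Th two_BA) (Omega eps X P) <->
        accepts_within P X (2 ^ size X)%N)
    (Omega_size : forall eps : R, 0 < eps ->
      forall P : machine A 1, exists N : nat,
        forall X : seq A, is_word X -> (N <= size X)%N ->
          (size X < size (code_sentence cO (Omega eps X P)))%N /\
          (size (code_sentence cO (Omega eps X P)))%:R <=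
            D eps * (size (code_machine cO P))%:R
              * (size X)%:R `^ (2 + eps)) :
  forall eps : R, 0 < eps ->
    let rho := (2 + eps)^-1 in
    ~ DTIME (fun n : nat => 2 `^ (D eps `^ (- rho) * n%:R `^ rho))
        (code_language cO (Th two_BA)).
Proof.
move=> eps eps0 rho [kM [M [c Mdec]]].
have e20 : 0 < eps / 2 by rewrite divr_gt0.
have rho0 : 0 <= rho by rewrite invr_ge0 addr_ge0 // ltW.
have [kW [W [g Wwrites]]] := Omega_written _ e20.
pose P := compile (decider W M); pose w := code_machine cO P.
have ww : is_word w by apply: code_word; constructor 3; exists P.
have [N1 size_out] := Omega_size _ e20 P.
pose q := g.[(size w)%:P].
(* The time bound of M, at the bound on the length of the sentence, is
   c * 2 `^ (kappa * n `^ delta). *)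
pose kappa := D eps `^ (- rho) * (D (eps / 2) * (size w)%:R) `^ rho.
pose delta := (2 + eps / 2) * rho.
have delta1 : delta < 1.
  by rewrite /delta /rho ltr_pdivrMr; lra.
have [N2 fits] := growth (overhead kW kM) q `|c| kappa delta1.
(* The padding makes X long enough for both asymptotic bounds. *)
pose X := packed w (N1 + N2).
pose out := code_sentence cO (Omega (eps / 2) X P).
have Xw : is_word X by apply: packed_word.
have sizeX : (N1 + N2 <= size X)%N by rewrite size_packed; lia.
have [_ le_out] := size_out X Xw (leq_trans (leq_addr _ _) sizeX).
have outw : is_word out.
  by apply: code_word; constructor 1; eexists.
have [tM le_tM] := Mdec out outw.
set final := run M tM _ => decided.
have halt : accepting final || rejecting final.
  by case: decided => -[-> _]; rewrite ?orbT.
have [t le_t result] := decider_run ww (Wwrites X P Xw) halt.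
have {}le_t : (t <= 2 ^ size X)%N.
  apply: leq_trans le_t _; apply: fits.
    exact: leq_trans (leq_addl _ _) sizeX.
  have D0 : 0 <= D (eps / 2) * (size w)%:R.
    by rewrite mulr_ge0 // ltW // D_gt0.
  have le_exp : D eps `^ (- rho) * (size out)%:R `^ rho
      <= kappa * (size X)%:R `^ delta.
    rewrite /kappa -mulrA ler_wpM2l ?powR_ge0 // /delta powRrM.
    rewrite -powRM ?powR_ge0 //.
    apply: ge0_ler_powR; rewrite ?nnegrE //.
    by apply: mulr_ge0 => //; exact: powR_ge0.
  apply: le_trans le_tM _; apply: (@le_trans _ _ (`|c| * _)).
    by apply: ler_wpM2r (ler_norm c); apply: powR_ge0.
  by rewrite ler_wpM2l // ler_powR // ler1n.
have correct := Omega_correct _ e20 P X Xw.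
rewrite -/final in result.
case: decided => -[fin Lout].
  (* M accepts: P rejects X, and accepts it since the sentence is true. *)
  rewrite fin in result.
  have [t' _ acc'] : accepts_within P X (2 ^ size X).
    by apply/correct/entails_Th/(code_languageE cO); exact: Lout.
  have rej : rejecting (run P t (initial 1 [:: X])).
    by rewrite /rejecting result.
  suff : accepting (run P t (initial 1 [:: X])) by rewrite /accepting result.
  have [le_tt'|/ltnW le_tt'] := leqP t t'.
    by rewrite -(run_after_halt _ le_tt') // rej orbT.
  by rewrite (run_after_halt _ le_tt') // acc'.
(* M rejects: P accepts X in time, so that the sentence is true. *)
case: Lout; apply/(code_languageE cO)/entails_Th/correct.
exists t => //; rewrite /accepting result ifF //.
by move: fin; rewrite /accepting /rejecting => /eqP ->.
Qed.
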